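(* Let $l$ be any prime number. Let $q\geqslant 3$ be a prime number with $l\neq q$. Let $\mathfrak{A}=\{\boldsymbol{\mu}_q\times(\boldsymbol{\mu}_n\rtimes_\chi\boldsymbol{\mu}_q)\}_{(n,\chi)\in\mathfrak{K}}$ be a Frobenius consistent balanced collection (with respect to $l$). Then there exist a field $\Bbbk\subset\overline{\mathbb{F}_l}$ and a non-trivial Severi--Brauer variety $X$ of dimension $q-1$ over $\mathbb{K}=\Bbbk(t)$, where $t$ is a transcendental variable, such that $\operatorname{Aut}(X)$ contains (a subgroup isomorphic to) every group $\boldsymbol{\mu}_q\times(\boldsymbol{\mu}_n\rtimes_\chi\boldsymbol{\mu}_q)\in\mathfrak{A}$.
   Context: A Severi--Brauer variety of dimension $m-1$ over a field $\mathbb{K}$ is an algebraic variety over $\mathbb{K}$ that becomes isomorphic to $\mathbb{P}^{m-1}$ after base change to an algebraic closure of $\mathbb{K}$; it is non-trivial if it is not isomorphic to $\mathbb{P}^{m-1}_{\mathbb{K}}$ over $\mathbb{K}$. $\boldsymbol{\mu}_n$ is the cyclic group of order $n$; $\boldsymbol{\mu}_n^*$ is the multiplicative group of residues modulo $n$ coprime to $n$, identified with $\operatorname{Aut}(\boldsymbol{\mu}_n)$ ($r$ acts by $x\mapsto x^r$). For a prime $q$, $\mathfrak{I}_q$ is the set of positive integers divisible only by primes congruent to $1$ modulo $q$. For $n=\prod_i p_i^{r_i}\in\mathfrak{I}_q$ one has canonically $\boldsymbol{\mu}_n^*\cong\prod_i\boldsymbol{\mu}_n(p_i)^*$ with $\boldsymbol{\mu}_n(p_i)^*\cong\boldsymbol{\mu}_{p_i^{r_i}}^*\cong\boldsymbol{\mu}_{p_i-1}\times\boldsymbol{\mu}_{p_i^{r_i-1}}$.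 A homomorphism $\chi:\boldsymbol{\mu}_q\to\boldsymbol{\mu}_n^*$ is balanced if its composition with each projection $\boldsymbol{\mu}_n^*\to\boldsymbol{\mu}_n(p_i)^*$ is injective. The image of any $\chi:\boldsymbol{\mu}_q\to\boldsymbol{\mu}_n^*$ lies in $\prod_{p\mid n}\boldsymbol{\mu}_{p-1}$, where $\boldsymbol{\mu}_{p-1}$ is the subgroup of order $p-1$ in $\boldsymbol{\mu}_{p^r}^*$ (identified for different $r$ via reduction modulo $p$). For $t\mid n$ let $\pi_{n,t}:\prod_{p\mid n}\boldsymbol{\mu}_{p-1}\to\prod_{p\mid t}\boldsymbol{\mu}_{p-1}$ be the projection. For $\chi_i:\boldsymbol{\mu}_q\to\boldsymbol{\mu}_{n_i}^*$, $i=1,2$, and $t=\gcd(n_1,n_2)$, the pair $(\operatorname{Im}\chi_1,\operatorname{Im}\chi_2)$ is consistent if $\pi_{n_1,t}(\operatorname{Im}\chi_1)=\pi_{n_2,t}(\operatorname{Im}\chi_2)$. A collection $\{\boldsymbol{\mu}_q\times(\boldsymbol{\mu}_n\rtimes_\chi\boldsymbol{\mu}_q)\}_{(n,\chi)\in\mathfrak{K}}$, where $\mathfrak{K}$ is a set of pairs with $n\in\mathfrak{I}_q$ and $\chi:\boldsymbol{\mu}_q\to\boldsymbol{\mu}_n^*$ balanced, is a consistent balanced collection if $(\operatorname{Im}\chi_1,\operatorname{Im}\chi_2)$ is consistent for all $(n_1,\chi_1),(n_2,\chi_2)\in\mathfrak{K}$. For $\gcd(n,l)=1$, $\operatorname{ord}_n(l)$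 is the minimal positive integer $r$ such that $n\mid l^r-1$; $v_q(m)$ is the maximal $r$ with $q^r\mid m$. A balanced $\chi:\boldsymbol{\mu}_q\to\boldsymbol{\mu}_n^*$ is of Frobenius type if, for a generator $y$ of $\boldsymbol{\mu}_q$, $\chi(y)$ is the automorphism $x\mapsto x^{l^{d_0\cdot d\cdot q^{k-1}}}$ of $\boldsymbol{\mu}_n$, where $\operatorname{ord}_n(l)=q^kd_0$ with $k\geqslant 1$, $q\nmid d_0$, and $1\leqslant d\leqslant q-1$; for $n=1$ this condition is void. For a positive integer $k$, $\mathfrak{I}_{k,q,l}$ is the set of positive integers divisible only by primes $p\neq l$ with $p\equiv 1\pmod q$ and $v_q(\operatorname{ord}_p(l))=k$. A consistent balanced collection is Frobenius if there is one positive integer $k$ such that all occurring $n$ lie in $\mathfrak{I}_{k,q,l}$ and all occurring $\chi$ are of Frobenius type. *)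

(* Defs.v *)
From HB Require Import structures.
From mathcomp Require Import all_boot all_order all_algebra all_fingroup.
From mathcomp Require Import all_solvable all_field.
From mathcomp Require Import mpoly.

Set Implicit Arguments.
Unset Strict Implicit.
Unset Printing Implicit Defensive.

Import GRing.Theory.
Local Open Scope ring_scope.

(** Varieties over a field K, in the language of a fixed algebraically closed
    extension phi : K -> L.  A projective K-variety is a closed subset of
    P(L^N) whose homogeneous ideal is generated by polynomials over K
    (equivalently, a geometrically reduced closed subscheme of projective space
    over K), and a K-morphism is a map on L-points that is given, Zariski
    locally, by homogeneous polynomials over K.  Base change from K to L keeps
    the point set and replaces phi by the identity of L. *)

(* P^{N-1}(L), as the set of lines of L^N. *)
Definition pspace (L : fieldType) (N : nat) : Type :=
  {P : {vspace 'rV[L]_N} | \dim P == 1%N}.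

Definition vanishes_at (L : fieldType) (N : nat) (F : {mpoly L[N]})
    (P : pspace L N) : Prop :=
  forall v : 'rV[L]_N, v \in val P -> F.@[v 0] = 0.

(* F belongs to the homogeneous ideal of S: it vanishes on the cone over S. *)
Definition vanishes_on (L : fieldType) (N : nat) (F : {mpoly L[N]})
    (S : pred (pspace L N)) : Prop :=
  forall P, S P -> vanishes_at F P.

Definition zariski_closed (L : fieldType) (N : nat) (S : pred (pspace L N)) :
    Prop :=
  forall P, ~~ S P ->
    exists F : {mpoly L[N]}, vanishes_on F S /\ ~ vanishes_at F P.

(* The ideal of S is spanned over L by the polynomials over K it contains. *)
Definition defined_over (K L : fieldType) (phi : {rmorphism K -> L}) (N : nat)
    (S : pred (pspace L N)) : Prop :=
  forall F : {mpoly L[N]}, vanishes_on F S ->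
    exists (r : nat) (c : 'I_r -> L) (G : 'I_r -> {mpoly K[N]}),
      (forall i, vanishes_on (map_mpoly phi (G i)) S) /\
      F = \sum_(i < r) c i *: map_mpoly phi (G i).

Record projective_variety (K L : fieldType) (phi : {rmorphism K -> L}) :=
  ProjectiveVariety {
    pv_dim : nat;
    pv_set : pred (pspace L pv_dim);
    pv_closed : zariski_closed pv_set;
    pv_defined : defined_over phi pv_set }.

Arguments pv_set {K L phi} X _ : rename.

Definition points (L : fieldType) (N : nat) (S : pred (pspace L N)) : Type :=
  {P : pspace L N | S P}.

Definition eval_row (K L : fieldType) (phi : {rmorphism K -> L}) (N M : nat)
    (F : 'I_M -> {mpoly K[N]}) (v : 'rV[L]_N) : 'rV[L]_M :=
  \row_i (map_mpoly phi (F i)).@[v 0].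

(* Near each point P, f is [x] |-> [F_1(x) : ... : F_M(x)] for forms F_i over K
   of the same degree.  The condition on Q says f Q = [F(Q)] whenever
   F(Q) <> 0, and is void when F(Q) = 0. *)
Definition regular (K L : fieldType) (phi : {rmorphism K -> L}) (N M : nat)
    (S : pred (pspace L N)) (T : pred (pspace L M))
    (f : points S -> points T) : Prop :=
  forall P : points S,
    exists (d : nat) (F : 'I_M -> {mpoly K[N]}),
      [/\ forall i, F i \is d.-homog,
          exists2 v, v \in val (val P) & eval_row phi F v != 0
        & forall Q : points S, forall v, v \in val (val Q) ->
            eval_row phi F v \in val (val (f Q))].

Definition isomorphic (K L : fieldType) (phi : {rmorphism K -> L}) (N M : nat)
    (S : pred (pspace L N)) (T : pred (pspace L M)) : Prop :=
  exists (f : points S -> points T) (g : points T -> points S),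
    [/\ regular phi f, regular phi g, cancel f g & cancel g f].

Definition automorphism (K L : fieldType) (phi : {rmorphism K -> L}) (N : nat)
    (S : pred (pspace L N)) (f : points S -> points S) : Prop :=
  exists g : points S -> points S,
    [/\ regular phi f, regular phi g, cancel f g & cancel g f].

Definition Aut_contains (K L : fieldType) (phi : {rmorphism K -> L})
    (X : projective_variety phi) (gT : finGroupType) : Prop :=
  exists rho : gT -> points (pv_set X) -> points (pv_set X),
    [/\ forall g, automorphism phi (rho g),
        forall g h, rho (g * h)%g =1 rho g \o rho h
      & forall g h, rho g =1 rho h -> g = h].

(* Here L is meant to be an algebraic closure of K.  P^{m-1} over K is the full
   set of points predT of pspace L m.  Every Severi--Brauer variety is
   projective, so that projective varieties are general enough. *)
Definition severi_brauer (K L : fieldType) (phi : {rmorphism K -> L})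
    (m : nat) (X : projective_variety phi) : Prop :=
  isomorphic (idfun : {rmorphism L -> L})
    (pv_set X) (predT : pred (pspace L m)).

Definition nontrivial_severi_brauer (K L : fieldType)
    (phi : {rmorphism K -> L}) (m : nat) (X : projective_variety phi) : Prop :=
  severi_brauer m X /\
  ~ isomorphic phi (pv_set X) (predT : pred (pspace L m)).

Definition is_algebraic_closure (F : fieldType) (L : closedFieldType)
    (phi : {rmorphism F -> L}) : Prop :=
  integralRange phi.

(** Groups.  mu_n is Zp n, a group in the additive group of 'Z_n (it is trivial
    for n = 1, although 'Z_1 is 'Z_2), mu_n^* is {unit 'Z_n} (also trivial for
    n = 1), and mu_q is the whole of 'Z_q, q being prime. *)

Notation mu_hom q n := {morphism [set: 'Z_q] >-> {unit 'Z_n}}.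

Section MuAction.
Variables (q n : nat) (chi : mu_hom q n).

(* The automorphism chi(y) of mu_n; x ^ r is written r x in 'Z_n. *)
Definition mu_act_fun (x : 'Z_n) (y : 'Z_q) : 'Z_n := x * val (chi y).

Lemma mu_act_fun1 : mu_act_fun^~ 1%g =1 id.
Proof. by move=> x; rewrite /mu_act_fun morph1 mulr1. Qed.

Lemma mu_act_funM x : act_morph mu_act_fun x.
Proof. by move=> a b; rewrite /mu_act_fun morphM ?inE //= mulrA. Qed.

Definition mu_action : {action 'Z_q &-> 'Z_n} :=
  TotalAction mu_act_fun1 mu_act_funM.

Lemma mu_action_is_groupAction : is_groupAction (Zp n) mu_action.
Proof.
move=> a _; rewrite inE; apply/andP; split; last first.
  apply/morphicP=> x y _ _; rewrite !actpermE.
  exact: (@mulrDl 'Z_n x y (val (chi a))).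
apply/subsetP=> x; rewrite inE actpermE /Zp.
case: ifP => [_ _|n1]; first by rewrite inE.
have chi1 : chi a = 1%g.
  have le1 : (#|{: {unit 'Z_n}}| <= 1)%N.
    by rewrite -cardsT; case: (n) n1 => [|[|?]] // _;
       exact: (eq_leq (@card_units_Zp 1 isT)).
  exact: (card_le1_eqP le1).
by rewrite /= /mu_act_fun chi1 mulr1 eqxx.
Qed.

Definition mu_groupAction := GroupAction mu_action_is_groupAction.

(* mu_q x (mu_n ><|_chi mu_q) *)
Definition mu_group : finGroupType :=
  ('Z_q * sdprod_by mu_groupAction)%type.

(* The residue modulo the p-part of n: the component in mu_n(p)^* of u. *)
Definition mu_proj (p : nat) (u : {unit 'Z_n}) : nat := ((val u : nat) %% n`_p)%N.

Definition balanced : Prop :=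
  forall p, p \in primes n -> injective (fun y => mu_proj p (chi y)).

(* pi_{n,t}, for t dividing n: the factors mu_{p-1} of mu_{p^r}^* being
   identified for all r through reduction modulo p, an element of their product
   over the p dividing t is the family of its residues modulo these p. *)
Definition pi_res (t : nat) (u : {unit 'Z_n}) : seq nat :=
  [seq ((val u : nat) %% p)%N | p <- primes t].

(* r is the multiplicative order of l modulo m. *)
Definition is_ord (m l r : nat) : Prop :=
  [/\ 0 < r, m %| l ^ r - 1
    & forall s, 0 < s -> m %| l ^ s - 1 -> r <= s]%N.

Definition frobenius_type (l : nat) : Prop :=
  n = 1%N \/
  exists (y : 'Z_q) (k d0 d : nat),
    [/\ generator [set: 'Z_q] y,
        is_ord n l (q ^ k * d0)%N,
        (1 <= k)%N /\ ~~ (q %| d0)%N,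
        (1 <= d <= q - 1)%N
      & val (chi y) = (l ^ (d0 * d * q ^ (k - 1)))%:R].

End MuAction.

(* The set I_q. *)
Definition in_I (q n : nat) : Prop :=
  (0 < n)%N /\ forall p, prime p -> (p %| n)%N -> p = 1 %[mod q].

(* The set I_{k,q,l}. *)
Definition in_Ikql (k q l n : nat) : Prop :=
  (0 < n)%N /\
  forall p, prime p -> (p %| n)%N ->
    [/\ p <> l, p = 1 %[mod q]
      & exists2 r, is_ord p l r & logn q r = k].

Definition consistent (q n1 n2 : nat) (chi1 : mu_hom q n1)
    (chi2 : mu_hom q n2) : Prop :=
  codom (fun y => pi_res (gcdn n1 n2) (chi1 y)) =i
  codom (fun y => pi_res (gcdn n1 n2) (chi2 y)).

(* The set of pairs (n, chi), possibly infinite, is given by its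
   characteristic predicate. *)
Definition consistent_balanced_collection (q : nat)
    (KK : forall n, mu_hom q n -> Prop) : Prop :=
  (forall n (chi : mu_hom q n), KK n chi -> in_I q n /\ balanced chi) /\
  (forall n1 (chi1 : mu_hom q n1) n2 (chi2 : mu_hom q n2),
     KK n1 chi1 -> KK n2 chi2 -> consistent chi1 chi2).

Definition frobenius_collection (q l : nat)
    (KK : forall n, mu_hom q n -> Prop) : Prop :=
  exists2 k, (0 < k)%N &
    forall n (chi : mu_hom q n), KK n chi ->
      in_Ikql k q l n /\ frobenius_type chi l.

(* Main.v *)
From HB Require Import structures.
Require Import Defs.
From mathcomp Require Import all_boot all_order all_algebra all_fingroup.
From mathcomp Require Import all_solvable all_field.
From mathcomp Require Import mpoly ring generic_quotient.
Set Implicit Arguments.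
Unset Strict Implicit.
Unset Printing Implicit Defensive.
Import GRing.Theory.
Local Open Scope ring_scope.

(** Let [kap] be the common value of v_q(ord_p(l)) for the primes p dividing the
    orders n that occur, and let k be the union of the fields F_{l^m} with m not
    divisible by q^kap.  The field k contains the q-th roots of unity but not
    all roots of unity of q-power order; if alpha is one of least order outside
    k, then alpha^q = c lies in k.  The variety is the Severi--Brauer variety of
    the symbol algebra (c, t) over K = k(t), made explicit as follows.  Over an
    algebraic closure L of K, with theta^q = t and zeta a primitive q-th root of
    unity, it is the image of P^{q-1} under the map [psi] with coordinates
      alpha^m theta^s sum_i zeta^(im) X_i^(q-1) X_(i+s)   (s, m in Z/q).
    Fourier inversion in m recovers the matrix X_i^(q-1) X_j from these
    coordinates, so the map is a closed embedding ([twisted_set_closed],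
    [twisted_severi_brauer]).

    The image is defined over K ([twisted_set_defined]).  The coordinate (s, m)
    is, up to alpha^m theta^s, an eigenvector for the cyclic shift and for
    diag(zeta^i).  A polynomial relation between the coordinates therefore
    splits into relations that are homogeneous for the two characters, and in
    each of them only the powers c = alpha^q and t = theta^q survive.  What is
    left is a linear system over K, whose kernel is spanned by solutions over K
    ([linear_relations_descend]).

    There is no K-point, hence no K-isomorphism with P^{q-1}
    ([twisted_nontrivial]): a K-point would exhibit t as a quotient of two norms
    from k(alpha)(t), while the degree in t of such a norm is a multiple of q
    ([X_not_norm_ratio]).

    On P^{q-1} the group mu_q x (mu_n x| mu_q) acts by the diagonal matrices
    diag(zeta^i), the diagonal matrices diag(xi^(lam^i)) with xi of order n, and
    cyclic shifts.  The first and the last act on the coordinates by elements of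
    K.  Here lam = l^M is chosen so that the l^M-power map sends alpha to
    zeta alpha ([Kummer_generator]) and xi to xi^lam; the matrix of the second
    kind then has entries of the form sum_i w^(lam^i), which are traces over k
    ([trace_small_q_degree]).  That chi is of Frobenius type means exactly that
    it takes its values among the powers of such a lam
    ([frobenius_exponent]). *)

(** * Polynomial functions and descent of linear relations *)

Lemma base_expansion_inj (B n : nat) (f g : 'I_n -> nat) :
  (forall i, (f i < B)%N) -> (forall i, (g i < B)%N) ->
  (\sum_i f i * B ^ i = \sum_i g i * B ^ i)%N -> f =1 g.
Proof.
elim: n f g => [f g _ _ _ [] //|n IHn] f g ltfB ltgB.
have B_gt0 : (0 < B)%N by apply: leq_ltn_trans (ltfB ord0).
have split_sum (h : 'I_n.+1 -> nat) : (\sum_i h i * B ^ i =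
    h ord0 + (\sum_(i < n) h (lift ord0 i) * B ^ i) * B)%N.
  rewrite big_ord_recl muln1 big_distrl /=; congr (_ + _)%N.
  by apply: eq_bigr => i _; rewrite /= expnSr mulnA.
rewrite !split_sum => eq_fg.
have eq0 : f ord0 = g ord0.
  move/(congr1 (modn^~ B)): eq_fg.
  by rewrite ![(_ + _ * B)%N]addnC !modnMDl !modn_small.
move: eq_fg; rewrite eq0 => /addnI/eqP; rewrite eqn_pmul2r // => /eqP eqS.
have{eqS} eqS := IHn _ _ (fun i => ltfB _) (fun i => ltgB _) eqS.
by move=> i; case: (unliftP ord0 i) => [j|] ->.
Qed.

(** Kronecker substitution X_i = x^(B^i), with B above all degrees, turns p into a
    univariate polynomial with the same coefficients. *)
Lemma mpoly_eq0_meval (L : closedFieldType) (n : nat) (p : {mpoly L[n]}) :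
  (forall v, p.@[v] = 0) -> p = 0.
Proof.
move=> p0; apply/mpolyP => m; rewrite mcoeff0.
have [mp|/memN_msupp_eq0 //] := boolP (m \in msupp p).
pose B := (msize p).+1; pose e (m' : 'X_{1..n}) := (\sum_i m' i * B ^ i)%N.
pose P : {poly L} := \sum_(m' <- msupp p) p@_m' *: 'X^(e m').
have P0 : P = 0.
  apply/eqP/negPn/negP => /closed_nonrootP[x /negP[]]; apply/eqP.
  rewrite -[RHS](p0 (fun i => x ^+ (B ^ i)%N)) mevalE horner_sum.
  apply: eq_bigr => m' _; rewrite hornerZ hornerXn; congr (_ * _).
  rewrite /e; elim/big_rec2: _ => [|i a b _ IH]; first by rewrite expr0.
  by rewrite exprD -IH mulnC exprM.
have ltB m' : m' \in msupp p -> forall i, (m' i < B)%N.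
  move=> m'p i; rewrite /B ltnS; apply: leq_trans (ltnW (msize_mdeg_lt m'p)).
  by rewrite mdegE (bigD1 i) //= leq_addr.
have := congr1 (fun r : {poly L} => r`_(e m)) P0.
rewrite coef0 coef_sum (bigD1_seq m) ?msupp_uniq //= coefZ coefXn eqxx mulr1.
rewrite big1_seq ?addr0 // => m' /andP[m'm m'p]; rewrite coefZ coefXn.
case: eqP => [eqe|]; last by rewrite mulr0.
case/eqP: m'm; apply/mnmP => i.
by apply: (base_expansion_inj (ltB _ m'p) (ltB _ mp)).
Qed.

(** The relations form the kernel of a matrix over K whose columns are indexed by
    j and the monomials of bounded degree; the kernel of a matrix over K has a
    basis over K.  The extra index j allows several simultaneous relations, one
    for each character of (Z/q)^2 below. *)
Lemma linear_relations_descend (K L : fieldType) (phi : {rmorphism K -> L})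
    (J : finType) (n r : nat) (G : J -> 'I_r -> {mpoly K[n]}) (c : 'I_r -> L) :
  (forall j, \sum_i c i *: map_mpoly phi (G j i) = 0) ->
  exists (D : 'I_r -> L) (B : 'I_r -> 'I_r -> K),
    (forall i, c i = \sum_h D h * phi (B h i)) /\
    (forall h j, \sum_i B h i *: G j i = 0).
Proof.
move=> cG0; pose d := \max_(p : J * 'I_r) msize (G p.1 p.2).
have Gd j i : (msize (G j i) <= d)%N by apply: (leq_bigmax (j, i)).
pose I := (J * 'X_{1..n < d})%type.
pose A := \matrix_(i < r, k < #|{: I}|) (G (enum_val k).1 i)@_((enum_val k).2).
have : ((\row_i c i) <= kermx (map_mx phi A))%MS.
  apply/sub_kermxP/rowP => k; rewrite !mxE.
  have := congr1 (mcoeff (enum_val k).2) (cG0 (enum_val k).1).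
  rewrite mcoeff0 raddf_sum /= => cA0; rewrite -[RHS]cA0; apply: eq_bigr => i _.
  by rewrite !mxE mcoeffZ mcoeff_map_mpoly.
rewrite -map_kermx => /submxP[D cE]; pose B := kermx A.
exists (D 0), (fun h i => B h i); split=> [i|h j].
  move/rowP/(_ i): cE; rewrite !mxE => ->.
  by apply: eq_bigr => h _; rewrite !mxE.
apply/mpolyP => m; rewrite mcoeff0 raddf_sum /=.
have [ltmd|lemd] := ltnP (mdeg m) d; last first.
  rewrite big1 // => i _; rewrite mcoeffZ memN_msupp_eq0 ?mulr0 //.
  apply: msize_mdeg_ge; exact: leq_trans (Gd j i) lemd.
have := congr1 (fun M : 'M_(_, _) => M h (enum_rank ((j, BMultinom ltmd) : I)))
  (mulmx_ker A); rewrite !mxE => BA0; rewrite -[RHS]BA0.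
by apply: eq_bigr => i _; rewrite !mxE enum_rankK mcoeffZ.
Qed.

Lemma closed_root_exists (L : closedFieldType) (n : nat) (b : L) :
  exists a, a ^+ n.+1 = b.
Proof.
have /closed_rootP[a /rootP] : size ('X^(n.+1) - b%:P : {poly L}) != 1.
  by rewrite size_XnsubC.
by rewrite !hornerE => /eqP; rewrite subr_eq0 => /eqP; exists a.
Qed.

Lemma mevalXn (R : comNzRingType) (n k : nat) (v : 'I_n -> R) (p : {mpoly R[n]}) :
  (p ^+ k).@[v] = p.@[v] ^+ k.
Proof. exact: rmorphXn. Qed.

Section EvaluationMorphisms.
Variables (R S : comNzRingType) (f : {rmorphism R -> S}) (n : nat).
Variables (I : Type) (r : seq I) (P : pred I).

Lemma meval_sum (v : 'I_n -> R) (F : I -> {mpoly R[n]}) :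
  (\sum_(i <- r | P i) F i).@[v] = \sum_(i <- r | P i) (F i).@[v].
Proof. exact: raddf_sum. Qed.

Lemma meval_prod (v : 'I_n -> R) (F : I -> {mpoly R[n]}) :
  (\prod_(i <- r | P i) F i).@[v] = \prod_(i <- r | P i) (F i).@[v].
Proof. exact: rmorph_prod. Qed.

Lemma map_mpoly_sum (F : I -> {mpoly R[n]}) :
  map_mpoly f (\sum_(i <- r | P i) F i) = \sum_(i <- r | P i) map_mpoly f (F i).
Proof. exact: raddf_sum. Qed.

Lemma map_mpoly_prod (F : I -> {mpoly R[n]}) :
  map_mpoly f (\prod_(i <- r | P i) F i) = \prod_(i <- r | P i) map_mpoly f (F i).
Proof. exact: rmorph_prod. Qed.

Lemma map_mpolyM (p p' : {mpoly R[n]}) :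
  map_mpoly f (p * p') = map_mpoly f p * map_mpoly f p'.
Proof. exact: rmorphM. Qed.

Lemma map_mpolyXn (p : {mpoly R[n]}) (k : nat) :
  map_mpoly f (p ^+ k) = map_mpoly f p ^+ k.
Proof. exact: rmorphXn. Qed.

End EvaluationMorphisms.

Lemma homog_mevalZ (R : comNzRingType) (n d : nat) (p : {mpoly R[n]}) (a : R)
    (v : 'rV[R]_n) :
  p \is d.-homog -> p.@[(a *: v) 0] = a ^+ d * p.@[v 0].
Proof.
move=> /dhomogP homp; rewrite !mevalE mulr_sumr; apply: eq_big_seq => m mp.
rewrite mulrCA; congr (_ * _); rewrite -(homp m mp) /= mdegE expr_sum -big_split.
by apply: eq_bigr => i _; rewrite mxE exprMn.
Qed.

Lemma meval_map_mpoly (R S : comNzRingType) (f : {rmorphism R -> S}) (n : nat)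
    (p : {mpoly R[n]}) (v : 'rV[R]_n) :
  (map_mpoly f p).@[map_mx f v 0] = f p.@[v 0].
Proof.
rewrite {1}[p]mpolyE map_mpoly_sum meval_sum mevalE rmorph_sum.
apply: eq_bigr => m _; rewrite map_mpolyZ map_mpolyX mevalZ mevalX rmorphM.
rewrite rmorph_prod; congr (_ * _); apply: eq_bigr => i _.
by rewrite mxE rmorphXn.
Qed.

(** * Projective points *)

Section ProjectiveSpace.
Variable L : fieldType.

Lemma pline_subproof (N : nat) (v : 'rV[L]_N) : v != 0 -> \dim <[v]> == 1%N.
Proof. by rewrite dim_vline => ->. Qed.

Definition pline (N : nat) (v : 'rV[L]_N) (nz_v : v != 0) : pspace L N :=
  exist _ <[v]>%VS (pline_subproof nz_v).

Lemma pspace_vpick_neq0 (N : nat) (P : pspace L N) : vpick (val P) != 0.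
Proof.
rewrite vpick0; apply: contraTneq (valP P) => ->; by rewrite dimv0.
Qed.

Lemma pspace_line (N : nat) (P : pspace L N) (v : 'rV[L]_N) :
  v \in val P -> v != 0 -> val P = <[v]>%VS.
Proof.
move=> Pv nz_v; apply/esym/eqP; rewrite eqEdim -memvE Pv /=.
by rewrite dim_vline nz_v (eqP (valP P)).
Qed.

Lemma vline_scale (N : nat) (a : L) (v : 'rV[L]_N) :
  a != 0 -> <[a *: v]>%VS = <[v]>%VS.
Proof.
move=> nz_a; apply/eqP; rewrite eqEsubv -!memvE memvZ ?memv_line //=.
by rewrite -[X in X \in _](scalerK nz_a) memvZ ?memv_line.
Qed.

Lemma map_mpoly_idfun (n : nat) (p : {mpoly L[n]}) : map_mpoly idfun p = p.
Proof. by apply/mpolyP => m; rewrite mcoeff_map_mpoly. Qed.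

End ProjectiveSpace.

(** * The twisted embedding of projective space *)

Section TwistedVariety.
Variables (K : fieldType) (L : closedFieldType) (phi : {rmorphism K -> L}).
Variable q' : nat.
Local Notation q := q'.+2.
Local Notation N := (q * q)%N.
Variables (zeta c t : K) (alpha theta : L).
Hypothesis prim_zeta : q.-primitive_root zeta.
Hypothesis q_neq0 : q%:R != 0 :> K.
Hypothesis alpha_q : alpha ^+ q = phi c.
Hypothesis theta_q : theta ^+ q = phi t.
Hypothesis alpha_neq0 : alpha != 0.
Hypothesis theta_neq0 : theta != 0.

Let z : L := phi zeta.

Let prim_z : q.-primitive_root z.
Proof. by rewrite /z fmorph_primitive_root. Qed.

Let z_neq0 : z != 0.
Proof.
apply: contra_eq_neq (prim_expr_order prim_z) => ->.
by rewrite expr0n eq_sym oner_neq0.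
Qed.

Let zX_neq0 m : z ^+ m != 0.
Proof. exact: expf_neq0. Qed.

Let qL_neq0 : q%:R != 0 :> L.
Proof. by rewrite -(rmorph_nat phi) fmorph_eq0. Qed.

Lemma root_addl (R : fieldType) (w : R) (i j : 'I_q) (m : nat) :
  w ^+ q = 1 -> w ^+ ((i + j)%R * m) = w ^+ (i * m) * w ^+ (j * m).
Proof.
move=> wq; rewrite -exprD -mulnDl [w ^+ (_ * _)]exprM [RHS]exprM /=.
by congr (_ ^+ m); rewrite expr_mod.
Qed.

Lemma root_orthogonality (i j : 'I_q) :
  \sum_(m < q) z ^+ (i * m) / z ^+ (j * m) = if i == j then q%:R else 0.
Proof.
pose w := z ^+ i / z ^+ j.
have -> : \sum_(m < q) z ^+ (i * m) / z ^+ (j * m) = \sum_(m < q) w ^+ m.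
  by apply: eq_bigr => m _; rewrite exprMn exprVn -!exprM.
case: (altP (i =P j)) => [eq_ij|ne_ij].
  rewrite /w eq_ij divff // (eq_bigr (fun=> 1)) => [|m _]; last exact: expr1n.
  by rewrite sumr_const card_ord.
have w1 : w != 1.
  rewrite /w -(inj_eq (mulIf (zX_neq0 j))) divfK // mul1r.
  by rewrite (eq_prim_root_expr prim_z) !modn_small.
apply: (mulfI (_ : w - 1 != 0)); first by rewrite subr_eq0.
rewrite -subrX1 mulr0 exprMn exprVn -!exprM mulnC exprM.
by rewrite [(j * _)%N]mulnC [X in _ / X]exprM (prim_expr_order prim_z) !expr1n divr1 subrr.
Qed.

Lemma root_orthogonality_sym (i j : 'I_q) :
  \sum_(m < q) z ^+ (m * i) / z ^+ (m * j) = if i == j then q%:R else 0.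
Proof.
by rewrite -root_orthogonality; apply: eq_bigr => m _; rewrite ![(m * _)%N]mulnC.
Qed.

(** The matrix of the embedding [x] -> [x_i^(q-1) x_j]: it is the Segre image of
    the graph of the (q-1)-st power map, so that all its nonzero rows represent
    the point [x]. *)
Definition powmx (X : 'rV[L]_q) : 'M[L]_q :=
  \matrix_(i, j) (X 0 i ^+ q.-1 * X 0 j).

(** The Fourier transform along the cyclic diagonals diagonalizes the cyclic shift
    of the indices; the factors alpha^m theta^s then twist the K-structure of the
    space of forms of degree q. *)
Definition twist (M : 'M[L]_q) : 'rV[L]_N :=
  mxvec (\matrix_(s < q, m < q)
    (alpha ^+ m * theta ^+ s * \sum_(i < q) z ^+ (i * m) * M i (i + s))).

Definition untwist (v : 'rV[L]_N) : 'M[L]_q :=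
  \matrix_(i, j) ((q%:R * theta ^+ (j - i)%R)^-1 *
     \sum_(m < q) (z ^+ (i * m) * alpha ^+ m)^-1 * vec_mx v (j - i) m).

Lemma twistK : cancel twist untwist.
Proof.
move=> M; apply/matrixP => i j; rewrite mxE /twist mxvecK.
set s := (j - i)%R; have -> : j = i + s by rewrite /s addrC subrK.
have nz_ts : theta ^+ s != 0 by exact: expf_neq0.
rewrite (eq_bigr (fun m : 'I_q => \sum_(k < q) theta ^+ s * M k (k + s) *
    (z ^+ (k * m) / z ^+ (i * m)))); last first.
  move=> m _; rewrite mxE !mulr_sumr; apply: eq_bigr => k _.
  have nz_am : alpha ^+ m != 0 by exact: expf_neq0.
  by field; rewrite nz_am zX_neq0.
rewrite exchange_big.
under eq_bigr => k _ do rewrite -mulr_sumr root_orthogonality.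
rewrite (bigD1 i) // big1 1?[X in _ * X]addr0 => [|k ne_ki].
  by rewrite eqxx; move: (q%:R : L) qL_neq0 => Q nzQ; field; rewrite ?nzQ ?nz_ts ?nz_am ?zX_neq0.
by rewrite (negPf ne_ki) mulr0.
Qed.

Lemma untwistK : cancel untwist twist.
Proof.
move=> v; rewrite -[RHS]vec_mxK; congr (mxvec _); apply/matrixP => s m.
have nz_ts : theta ^+ s != 0 by exact: expf_neq0.
have nz_am (k : 'I_q) : alpha ^+ k != 0 by exact: expf_neq0.
rewrite mxE (eq_bigr (fun i : 'I_q => \sum_(k < q)
    ((q%:R * theta ^+ s)^-1 * vec_mx v s k / alpha ^+ k) *
    (z ^+ (i * m) / z ^+ (i * k)))); last first.
  move=> i _; rewrite mxE addrAC subrr add0r !mulr_sumr.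
  by apply: eq_bigr => k _; move: (q%:R : L) qL_neq0 => Q nzQ; field; rewrite ?nzQ ?nz_ts ?nz_am ?zX_neq0.
rewrite exchange_big.
under eq_bigr => k _ do rewrite -mulr_sumr root_orthogonality_sym.
rewrite (bigD1 m) // big1 1?[X in _ * X]addr0 => [|k ne_km].
  by rewrite eqxx; move: (q%:R : L) qL_neq0 => Q nzQ; field; rewrite ?nzQ ?nz_ts ?nz_am ?zX_neq0.
by rewrite eq_sym (negPf ne_km) mulr0.
Qed.

Lemma twistZ a M : twist (a *: M) = a *: twist M.
Proof.
rewrite /twist -linearZ; congr (mxvec _); apply/matrixP => s m; rewrite !mxE.
rewrite [RHS]mulrCA; congr (_ * _); rewrite mulr_sumr.
by apply: eq_bigr => i _; rewrite mxE mulrCA.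
Qed.

Lemma powmxZ a X : powmx (a *: X) = a ^+ q *: powmx X.
Proof.
apply/matrixP => i j; rewrite !mxE exprMn mulrACA; congr (_ * _).
by rewrite -exprSr.
Qed.

Definition psi (X : 'rV[L]_q) : 'rV[L]_N := twist (powmx X).

Lemma psiZ a X : psi (a *: X) = a ^+ q *: psi X.
Proof. by rewrite /psi powmxZ twistZ. Qed.

Lemma twist0 : twist 0 = 0.
Proof. by have := twistZ 0 0; rewrite !scale0r. Qed.

Lemma psi_neq0 X : X != 0 -> psi X != 0.
Proof.
apply: contraNneq; rewrite /psi -[RHS]twist0 => /(can_inj twistK) powX0.
apply/eqP/rowP => i; move/matrixP/(_ i i): powX0; rewrite !mxE -exprSr.
by move/eqP; rewrite expf_eq0 => /andP[_ /eqP].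
Qed.

(** Every row of the matrix X_i^(q-1) X_j is a multiple of X. *)
Definition unpsi (v : 'rV[L]_N) : 'rV[L]_q :=
  if [pick r | row r (untwist v) != 0] is Some r then row r (untwist v) else 0.

Lemma unpsi_neq0 v : v != 0 -> unpsi v != 0.
Proof.
rewrite /unpsi; case: pickP => // rows0 /eqP[].
apply: (can_inj untwistK); rewrite -[in RHS]twist0 twistK.
by apply/row_matrixP => r; move/negbFE/eqP: (rows0 r) => ->; rewrite row0.
Qed.

Lemma row_untwist_psi b X r :
  row r (untwist (b *: psi X)) = (b * X 0 r ^+ q.-1) *: X.
Proof.
rewrite /psi -twistZ twistK; apply/rowP => j.
by rewrite !mxE mulrA.
Qed.

Lemma unpsi_psi b X : b != 0 -> X != 0 ->
  exists2 a, a != 0 & unpsi (b *: psi X) = a *: X.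
Proof.
move=> nz_b nz_X.
have : unpsi (b *: psi X) != 0.
  by rewrite unpsi_neq0 // scaler_eq0 negb_or nz_b psi_neq0.
rewrite /unpsi; case: pickP => [r _|_]; last by rewrite eqxx.
rewrite row_untwist_psi scaler_eq0 negb_or => /andP[nz_a _].
by exists (b * X 0 r ^+ q.-1).
Qed.

(** Testing whether a point is in the image of [psi] needs no quantifier: the only
    candidate for the preimage is read off the point by [unpsi]. *)
Definition twisted_set : pred (pspace L N) :=
  fun P => val P == <[psi (unpsi (vpick (val P)))]>%VS.

Lemma twisted_setP (P : pspace L N) :
  reflect (exists2 X, X != 0 & val P = <[psi X]>%VS) (twisted_set P).
Proof.
apply: (iffP eqP) => [|[X nz_X PE]].
  by exists (unpsi (vpick (val P))) => //; rewrite unpsi_neq0 ?pspace_vpick_neq0.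
have /vlineP[b vE] : vpick (val P) \in <[psi X]>%VS by rewrite -PE memv_pick.
have nz_b : b != 0.
  by apply: contraTneq (pspace_vpick_neq0 P) => b0; rewrite vE b0 scale0r eqxx.
rewrite vE; have [a nz_a ->] := unpsi_psi nz_b nz_X.
by rewrite PE psiZ vline_scale ?expf_neq0.
Qed.

(** Scalars are absorbed by [psi], since it is of degree q and L contains q-th
    roots; so vanishing on the set is the same as vanishing after composition
    with [psi]. *)
Lemma twisted_set_cone (P : pspace L N) v :
  twisted_set P -> v \in val P -> exists X, v = psi X.
Proof.
case/twisted_setP=> X _ -> /vlineP[b ->]; have [a <-] := closed_root_exists q.-1 b.
by exists (a *: X); rewrite psiZ.
Qed.

Lemma vanishes_on_twisted_set (F : {mpoly L[N]}) :
  vanishes_on F twisted_set <-> forall X, F.@[psi X 0] = 0.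
Proof.
split=> [F0 X|F0 P SP v Pv]; last by have [X ->] := twisted_set_cone SP Pv.
have [->|nz_X] := eqVneq X 0; last first.
  apply: (F0 (pline (psi_neq0 nz_X))); last exact: memv_line.
  by apply/twisted_setP; exists X.
have nz1 : psi (const_mx 1) != 0.
  by apply: psi_neq0; apply/eqP => /rowP/(_ ord0)/eqP; rewrite !mxE oner_eq0.
apply: (F0 (pline nz1)); first by apply/twisted_setP; exists (const_mx 1) => //;
  by apply/eqP => /rowP/(_ ord0)/eqP; rewrite !mxE oner_eq0.
by rewrite -(scale0r 0) psiZ expr0n scale0r mem0v.
Qed.

Definition entry (i j : 'I_q) : {mpoly L[N]} :=
  (q%:R * theta ^+ (j - i)%R)^-1 *: \sum_(m < q)
     (z ^+ (i * m) * alpha ^+ m)^-1 *: 'X_(mxvec_index (j - i) m).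

Lemma entryE i j (v : 'rV[L]_N) : (entry i j).@[v 0] = untwist v i j.
Proof.
rewrite mxE mevalZ raddf_sum /=; congr (_ * _); apply: eq_bigr => m _.
by rewrite mevalZ mevalXU mxE.
Qed.

Lemma entry_homog i j : entry i j \is 1.-homog.
Proof.
apply: dhomogZ; apply: rpred_sum => m _; apply: dhomogZ.
by rewrite dhomogX /= mdeg1.
Qed.

(** In terms of M = X_i^(q-1) X_j the equations are
    M_ij M_rk^q = M_kk M_ri^(q-1) M_rj.  If M_rk is nonzero, they say that M is a
    multiple of the matrix attached to its row r. *)
Lemma twisted_set_closed : zariski_closed twisted_set.
Proof.
move=> P nSP; pose v := vpick (val P).
pose E i j r k : {mpoly L[N]} :=
  entry i j * entry r k ^+ q - entry k k * (entry r i ^+ q.-1 * entry r j).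
have Ev i j r k (w : 'rV[L]_N) : (E i j r k).@[w 0] =
    untwist w i j * untwist w r k ^+ q -
    untwist w k k * (untwist w r i ^+ q.-1 * untwist w r j).
  by rewrite /E mevalB mevalM mevalXn mevalM mevalM mevalXn !entryE.
have [E0|] := boolP [forall i, forall j, forall r, forall k, (E i j r k).@[v 0] == 0].
  case/negP: nSP; apply/twisted_setP.
  have := unpsi_neq0 (pspace_vpick_neq0 P); rewrite -/v /unpsi.
  case: pickP => [r nz_r _|_]; last by rewrite eqxx.
  have [k nz_k] : exists k, untwist v r k != 0.
    apply/existsP; rewrite -[X in is_true X]negbK negb_exists.
    apply: contra nz_r => /forallP r0; apply/eqP/rowP => k.
    by rewrite mxE [RHS]mxE; exact/eqP/negPn/r0.
  pose X := row r (untwist v); exists X => //.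
  pose b := untwist v k k / untwist v r k ^+ q.
  have vE : v = b *: psi X.
    apply: (can_inj untwistK); rewrite /psi -twistZ twistK.
    apply/matrixP => i j; have := E0.
    move=> /forallP/(_ i)/forallP/(_ j)/forallP/(_ r)/forallP/(_ k).
    rewrite Ev subr_eq0 => /eqP eqE; rewrite [RHS]mxE [in RHS]mxE /b mulrAC.
    rewrite ![row _ _ _ _]mxE -eqE mulfK // expf_neq0 //.
  have nz_b : b != 0.
    apply: contraTneq (pspace_vpick_neq0 P) => b0.
    by rewrite -/v vE b0 scale0r eqxx.
  rewrite (pspace_line (memv_pick _) (pspace_vpick_neq0 P)) -/v vE.
  by rewrite vline_scale.
rewrite negb_forall => /existsP[i]; rewrite negb_forall => /existsP[j].
rewrite negb_forall => /existsP[r]; rewrite negb_forall => /existsP[k] nzE.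
exists (E i j r k).
split; last by move=> /(_ v (memv_pick _))/eqP; apply/negP.
apply/vanishes_on_twisted_set => X; rewrite Ev /psi twistK !mxE.
rewrite [q.-1]/= !exprMn !(exprSr _ q'.+1); set A := X 0 r ^+ q'.+1; ring.
Qed.

(** * Descent of the ideal *)

Definition coordpoly (s m : 'I_q) : {mpoly K[q]} :=
  \sum_(i < q) zeta ^+ (i * m) *: ('X_i ^+ q.-1 * 'X_(i + s)).

Lemma coordpolyE (s m : 'I_q) (X : 'rV[L]_q) :
  (map_mpoly phi (coordpoly s m)).@[X 0] =
  \sum_(i < q) z ^+ (i * m) * (X 0 i ^+ q.-1 * X 0 (i + s)).
Proof.
rewrite /coordpoly map_mpoly_sum meval_sum; apply: eq_bigr => i _.
rewrite map_mpolyZ mevalZ rmorphXn map_mpolyM map_mpolyXn !map_mpolyX.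
by rewrite mevalM mevalXn !mevalXU.
Qed.

Lemma psiE (s m : 'I_q) (X : 'rV[L]_q) :
  psi X 0 (mxvec_index s m) =
  alpha ^+ m * theta ^+ s * (map_mpoly phi (coordpoly s m)).@[X 0].
Proof.
rewrite mxvecE mxE coordpolyE; congr (_ * _).
by apply: eq_bigr => i _; rewrite mxE.
Qed.

(** The exponents of alpha and of theta in the monomial e of the coordinates of
    [psi]; only their residues modulo q matter, up to factors in K. *)
Definition adeg (e : 'X_{1..N}) : nat :=
  (\sum_(p : 'I_q * 'I_q) p.2 * e (mxvec_index p.1 p.2))%N.
Definition tdeg (e : 'X_{1..N}) : nat :=
  (\sum_(p : 'I_q * 'I_q) p.1 * e (mxvec_index p.1 p.2))%N.

Definition psimon (e : 'X_{1..N}) : {mpoly K[q]} :=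
  \prod_(p : 'I_q * 'I_q) coordpoly p.1 p.2 ^+ e (mxvec_index p.1 p.2).

Definition bideg (e : 'X_{1..N}) : 'I_q * 'I_q := (inZp (tdeg e), inZp (adeg e)).

(** The monomial e composed with [psi] and divided by theta^j.1 alpha^j.2; the
    powers of theta^q = t and alpha^q = c that are left make it a polynomial
    over K. *)
Definition psipart (j : 'I_q * 'I_q) (e : 'X_{1..N}) : {mpoly K[q]} :=
  if bideg e == j then
    (t ^+ (tdeg e %/ q) * c ^+ (adeg e %/ q)) *: psimon e else 0.

Lemma psimonE (e : 'X_{1..N}) (X : 'rV[L]_q) :
  ('X_[e] : {mpoly L[N]}).@[psi X 0] =
  alpha ^+ adeg e * theta ^+ tdeg e * (map_mpoly phi (psimon e)).@[X 0].
Proof.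
rewrite mevalX (reindex _ (curry_mxvec_bij _ _)) /=.
rewrite /psimon map_mpoly_prod meval_prod /adeg /tdeg !expr_sum -!big_split /=.
apply: eq_bigr => -[s m] _ /=; rewrite psiE map_mpolyXn mevalXn !exprMn.
by rewrite -!exprM.
Qed.

Lemma psipartE (e : 'X_{1..N}) (X : 'rV[L]_q) :
  ('X_[e] : {mpoly L[N]}).@[psi X 0] =
  \sum_(j : 'I_q * 'I_q) theta ^+ j.1 * alpha ^+ j.2 * (map_mpoly phi (psipart j e)).@[X 0].
Proof.
rewrite psimonE (bigD1 (bideg e)) //= big1 ?addr0 => [|j ne_j]; last first.
  by rewrite /psipart eq_sym (negPf ne_j) rmorph0 meval0 mulr0.
rewrite /psipart eqxx map_mpolyZ mevalZ rmorphM !rmorphXn /=.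
rewrite -theta_q -alpha_q -!exprM mulrA; congr (_ * _).
have split_exp (w : L) d : w ^+ d = w ^+ (d %% q) * w ^+ (q * (d %/ q)).
  by rewrite -exprD addnC mulnC -divn_eq.
by rewrite (split_exp alpha) (split_exp theta) /=; ring.
Qed.

(** The Heisenberg group, which acts on the coordinates of [psi] through
    characters of (Z/q)^2. *)
Definition heisenberg (a b : 'I_q) (X : 'rV[L]_q) : 'rV[L]_q :=
  \row_i (z ^+ (i * a) * X 0 (i - b)).

Lemma coordpoly_heisenberg (a b s m : 'I_q) (X : 'rV[L]_q) :
  (map_mpoly phi (coordpoly s m)).@[heisenberg a b X 0] =
  z ^+ (s * a) * z ^+ (m * b) * (map_mpoly phi (coordpoly s m)).@[X 0].
Proof.
have zq : z ^+ q = 1 by exact: prim_expr_order.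
(* forms of degree q are invariant under q-th roots of unity *)
have zz k : (z ^+ k) ^+ q.-1 * z ^+ k = 1.
  by rewrite -exprSr -exprM mulnC exprM zq expr1n.
rewrite !coordpolyE mulr_sumr (reindex_inj (addIr b)).
apply: eq_bigr => i _; rewrite !mxE addrK [(i + b + s)%R]addrAC addrK !root_addl // !exprMn.
rewrite [(m * b)%N]mulnC.
have zi := zz (i * a)%N; have zb := zz (b * a)%N.
move: (z ^+ (i * a)) (z ^+ (b * a)) zi zb => A B zA zB.
transitivity ((A ^+ q.-1 * A) * (B ^+ q.-1 * B) * (z ^+ (s * a) *
    z ^+ (b * m) * (z ^+ (i * m) * (X 0 i ^+ q.-1 * X 0 (i + s))))).
  by ring.
by rewrite zA zB !mul1r.
Qed.

Lemma psipart_heisenberg (a b : 'I_q) (j : 'I_q * 'I_q) (e : 'X_{1..N})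
    (X : 'rV[L]_q) :
  (map_mpoly phi (psipart j e)).@[heisenberg a b X 0] =
  z ^+ (j.1 * a) * z ^+ (j.2 * b) * (map_mpoly phi (psipart j e)).@[X 0].
Proof.
have zq : z ^+ q = 1 by exact: prim_expr_order.
rewrite /psipart; case: eqP => [<-|_]; last by rewrite rmorph0 !meval0 mulr0.
rewrite map_mpolyZ !mevalZ mulrCA; congr (_ * _).
have zmod d k : z ^+ (d %% q * k) = z ^+ (d * k).
  by rewrite exprM (prim_expr_mod prim_z) -exprM.
rewrite /= !zmod /psimon map_mpoly_prod !meval_prod /adeg /tdeg !big_distrl /=.
rewrite !expr_sum -!big_split; apply: eq_bigr => -[s m] _ /=.
rewrite map_mpolyXn !mevalXn coordpoly_heisenberg !exprMn -!exprM.
by rewrite ![(_ * e _ * _)%N]mulnAC.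
Qed.

Lemma root_character_inversion (h : 'I_q * 'I_q -> L) :
  (forall a b : 'I_q, \sum_(j : 'I_q * 'I_q) z ^+ (j.1 * a) * z ^+ (j.2 * b) * h j = 0) ->
  forall j, h j = 0.
Proof.
move=> h0 j0.
have : \sum_(a < q) \sum_(b < q) (z ^+ (j0.1 * a) * z ^+ (j0.2 * b))^-1 *
    \sum_(j : 'I_q * 'I_q) z ^+ (j.1 * a) * z ^+ (j.2 * b) * h j = 0.
  by apply: big1 => a _; apply: big1 => b _; rewrite h0 mulr0.
under eq_bigr => a _ do under eq_bigr => b _ do rewrite mulr_sumr.
under eq_bigr => a _ do rewrite exchange_big.
rewrite exchange_big (bigD1 j0) //= [X in _ + X]big1 ?addr0 => [|j ne_j].
  under eq_bigr => a _ do under eq_bigr => b _ do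
    rewrite mulrA mulVf ?mulf_neq0 // mul1r.
  rewrite !sumr_const !card_ord -[X in X = 0]mulr_natl -[X in _ * X]mulr_natl.
  by move/eqP; rewrite !mulf_eq0 !(negPf qL_neq0) => /eqP.
have E (a b : 'I_q) : (z ^+ (j0.1 * a) * z ^+ (j0.2 * b))^-1 *
    (z ^+ (j.1 * a) * z ^+ (j.2 * b) * h j) =
    h j * (z ^+ (j.1 * a) / z ^+ (j0.1 * a)) *
    (z ^+ (j.2 * b) / z ^+ (j0.2 * b)).
  by field; rewrite !zX_neq0.
under eq_bigr => a _ do (under eq_bigr => b _ do rewrite E; rewrite -mulr_sumr).
rewrite -mulr_suml -mulr_sumr !root_orthogonality.
case: eqP => [e1|_]; last by rewrite mulr0 mul0r.
case: eqP => [e2|_]; last by rewrite mulr0.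
by case/eqP: ne_j; case: (j) (j0) e1 e2 => [? ?] [? ?] /= -> ->.
Qed.

(** The translates of a relation by the Heisenberg group are relations, hence so
    are its isotypic parts; each of these is a system over K. *)
Lemma twisted_set_defined : defined_over phi twisted_set.
Proof.
move=> F /vanishes_on_twisted_set F0.
pose r := size (msupp F); pose e (i : 'I_r) := nth 0%MM (msupp F) i.
have FE : F = \sum_(i < r) F@_(e i) *: 'X_[e i].
  by rewrite [LHS]mpolyE (big_nth 0%MM) big_mkord.
have psiF0 j : \sum_i F@_(e i) *: map_mpoly phi (psipart j (e i)) = 0.
  apply: mpoly_eq0_meval => v; pose X : 'rV[L]_q := \row_i v i.
  rewrite -(meval_eq _ (_ : X 0 =1 v)) => [|i]; last by rewrite mxE.
  pose w (j : 'I_q * 'I_q) := theta ^+ j.1 * alpha ^+ j.2.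
  have nz_w j' : w j' != 0 by rewrite mulf_neq0 ?expf_neq0.
  apply: (mulfI (nz_w j)); rewrite mulr0.
  apply: (@root_character_inversion (fun j =>
    w j * (\sum_i F@_(e i) *: map_mpoly phi (psipart j (e i))).@[X 0])).
  move=> a b; rewrite -[RHS](F0 (heisenberg a b X)) {2}FE.
  rewrite [RHS]meval_sum.
  under [RHS]eq_bigr => i _ do rewrite mevalZ psipartE mulr_sumr.
  rewrite exchange_big; apply: eq_bigr => j' _; rewrite meval_sum !mulr_sumr.
  apply: eq_bigr => i _; rewrite mevalZ psipart_heisenberg -/(w j').
  by ring.
have [D [B [FD psiB0]]] := linear_relations_descend psiF0.
exists r, D, (fun h => \sum_i B h i *: 'X_[e i]); split=> [h|]; last first.
  rewrite {1}FE; under eq_bigr => i _ do rewrite FD scaler_suml.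
  rewrite exchange_big; apply: eq_bigr => h _.
  rewrite map_mpoly_sum scaler_sumr; apply: eq_bigr => i _.
  by rewrite map_mpolyZ map_mpolyX scalerA.
apply/vanishes_on_twisted_set => X; rewrite map_mpoly_sum meval_sum.
under eq_bigr => i _ do rewrite map_mpolyZ map_mpolyX mevalZ psipartE mulr_sumr.
rewrite exchange_big big1 // => j _.
transitivity (theta ^+ j.1 * alpha ^+ j.2 *
   (map_mpoly phi (\sum_i B h i *: psipart j (e i))).@[X 0]); last first.
  by rewrite psiB0 rmorph0 meval0 mulr0.
rewrite map_mpoly_sum meval_sum mulr_sumr; apply: eq_bigr => i _.
by rewrite map_mpolyZ mevalZ; ring.
Qed.

(** * Isomorphisms and automorphisms *)

Definition twisted_variety : projective_variety phi :=
  ProjectiveVariety twisted_set_closed twisted_set_defined.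

Lemma twisted_set_pline (X : 'rV[L]_q) (nz_X : X != 0) :
  twisted_set (pline (psi_neq0 nz_X)).
Proof. by apply/twisted_setP; exists X. Qed.

Definition twisted_point (X : 'rV[L]_q) (nz_X : X != 0) : points twisted_set :=
  exist (fun P => is_true (twisted_set P)) _ (twisted_set_pline nz_X).

Lemma twisted_pointP (P : points twisted_set) :
  exists (X : 'rV[L]_q) (nz_X : X != 0), P = twisted_point nz_X.
Proof.
have /twisted_setP[X nz_X PE] := valP P; exists X, nz_X.
by apply/val_inj/val_inj.
Qed.

Lemma eq_twisted_point (a : L) (X Y : 'rV[L]_q) (nz_X : X != 0) (nz_Y : Y != 0) :
  Y = a *: X -> twisted_point nz_X = twisted_point nz_Y.
Proof.
move=> YE; apply/val_inj/val_inj => /=; rewrite YE psiZ vline_scale //.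
by apply: expf_neq0; apply: contraNneq nz_Y => a0; rewrite YE a0 scale0r.
Qed.

Definition twisted_coord (P : points twisted_set) : 'rV[L]_q :=
  unpsi (vpick (val (val P))).

Lemma twisted_coord_neq0 (P : points twisted_set) : twisted_coord P != 0.
Proof. by rewrite unpsi_neq0 ?pspace_vpick_neq0. Qed.

Lemma twisted_coord_point (X : 'rV[L]_q) (nz_X : X != 0) :
  exists2 a, a != 0 & twisted_coord (twisted_point nz_X) = a *: X.
Proof.
have /vlineP[b vE] := memv_pick (val (val (twisted_point nz_X))).
have nz_b : b != 0.
  apply: contraTneq (pspace_vpick_neq0 (val (twisted_point nz_X))) => b0.
  by rewrite vE b0 scale0r eqxx.
by rewrite /twisted_coord vE; apply: unpsi_psi.
Qed.

Lemma twisted_point_inj (X Y : 'rV[L]_q) (nz_X : X != 0) (nz_Y : Y != 0) :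
  twisted_point nz_X = twisted_point nz_Y -> exists a, X = a *: Y.
Proof.
move/(congr1 twisted_coord); have [a nz_a ->] := twisted_coord_point nz_X.
have [b _ ->] := twisted_coord_point nz_Y => XY.
by exists (a^-1 * b); rewrite -scalerA -XY scalerK.
Qed.

Lemma twisted_severi_brauer : severi_brauer q twisted_variety.
Proof.
pose f (P : points twisted_set) : points (predT : pred (pspace L q)) :=
  exist (fun P => is_true (predT P)) (pline (twisted_coord_neq0 P)) isT.
pose g (P : points (predT : pred (pspace L q))) : points twisted_set :=
  twisted_point (pspace_vpick_neq0 (val P)).
have fE X nz_X : val (val (f (@twisted_point X nz_X))) = <[X]>%VS.
  by have [a nz_a E] := twisted_coord_point nz_X; rewrite /= E vline_scale.
have gE (P : points (predT : pred (pspace L q))) X (nz_X : X != 0) :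
    X \in val (val P) -> g P = twisted_point nz_X.
  rewrite {1}(pspace_line (memv_pick (val (val P))) (pspace_vpick_neq0 _)).
  by case/vlineP=> a; apply: eq_twisted_point.
exists f, g; split=> [P|P|P|P].
- have [X [nz_X ->]] := twisted_pointP P.
  have [r nz_r] : exists r, X 0 r != 0.
    apply/existsP; rewrite -[X in is_true X]negbK negb_exists.
    apply: contra nz_X => /forallP r0; apply/eqP/rowP => k.
    by rewrite [RHS]mxE; exact/eqP/negPn/r0.
  have evalE Y b : eval_row idfun (entry r) (b *: psi Y) =
      (b * Y 0 r ^+ q.-1) *: Y.
    apply/rowP => i; rewrite mxE map_mpoly_idfun entryE.
    by rewrite -row_untwist_psi [RHS]mxE.
  exists 1%N, (entry r); split=> [i||Q v].
  + exact: entry_homog.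
  + exists (psi X); first exact: memv_line.
    by rewrite -[psi X]scale1r evalE scaler_eq0 negb_or nz_X mul1r expf_neq0.
  have [Y [nz_Y ->]] := twisted_pointP Q; rewrite fE => /vlineP[b ->].
  by rewrite evalE memvZ ?memv_line.
- pose F (h : 'I_N) : {mpoly L[q]} :=
    mxvec (\matrix_(s < q, m < q) ((alpha ^+ m * theta ^+ s) *:
      map_mpoly phi (coordpoly s m))) 0 h.
  have FE (X : 'rV[L]_q) : eval_row idfun F X = psi X.
    apply/rowP => h; rewrite mxE map_mpoly_idfun.
    by case/mxvec_indexP: h => s m; rewrite psiE /F mxvecE mxE mevalZ.
  exists q, F; split=> [h||Q v Qv].
  + rewrite /F; case/mxvec_indexP: h => s m; rewrite mxvecE mxE.
    apply: dhomogZ; rewrite map_mpoly_sum; apply: rpred_sum => i _.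
    rewrite map_mpolyZ map_mpolyM map_mpolyXn !map_mpolyX; apply: dhomogZ.
    rewrite -[X in X.-homog]addn1; apply: dhomogM; last first.
      by rewrite dhomogX /= mdeg1.
    by rewrite mpolyXn dhomogX /= mdegMn mdeg1 mul1n.
  + exists (vpick (val (val P))); first exact: memv_pick.
    by rewrite FE psi_neq0 ?pspace_vpick_neq0.
  rewrite FE; have [->|nz_v] := eqVneq v 0.
    by rewrite -(scale0r 0) psiZ expr0n scale0r mem0v.
  by rewrite (gE Q v nz_v Qv) /= memv_line.
- have [X [nz_X ->]] := twisted_pointP P.
  by apply: gE; rewrite fE memv_line.
- apply/val_inj/val_inj; rewrite fE.
  by rewrite -(pspace_line (memv_pick _) (pspace_vpick_neq0 _)).
Qed.

Definition twisted_map (T : 'rV[L]_q -> 'rV[L]_q)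
    (nzT : forall X, X != 0 -> T X != 0) (P : points twisted_set) : points twisted_set :=
  twisted_point (nzT _ (twisted_coord_neq0 P)).

(** A projective representation T of gT on L^q acts on the twisted variety over K
    as soon as it acts linearly over K on the coordinates of [psi]. *)
Lemma twisted_Aut_contains (gT : finGroupType)
    (T : gT -> 'rV[L]_q -> 'rV[L]_q) :
  (forall g a X, T g (a *: X) = a *: T g X) ->
  (forall g X, X != 0 -> T g X != 0) ->
  (forall X, T 1%g X = X) ->
  (forall g h X, exists a, T g (T h X) = a *: T (g * h)%g X) ->
  (forall g h, (forall X, exists a, T g X = a *: T h X) -> g = h) ->
  (forall g, exists F : 'I_N -> {mpoly K[N]}, (forall h, F h \is 1.-homog) /\
     forall b X, eval_row phi F (b *: psi X) = b *: psi (T g X)) ->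
  Aut_contains twisted_variety gT.
Proof.
move=> TZ nzT T1 TM Tinj Trat.
pose rho g := twisted_map (nzT g).
have rhoE g X (nz_X : X != 0) : rho g (twisted_point nz_X) = twisted_point (nzT g _ nz_X).
  have [a nz_a aE] := twisted_coord_point nz_X; apply/esym/(eq_twisted_point (a := a)).
  by rewrite aE TZ.
have rho1 : rho 1%g =1 id.
  move=> P; have [X [nz_X ->]] := twisted_pointP P; rewrite rhoE.
  by apply: (eq_twisted_point (a := 1)); rewrite scale1r T1.
have rhoM g h : rho (g * h)%g =1 rho g \o rho h.
  move=> P; have [X [nz_X ->]] := twisted_pointP P; rewrite /= !rhoE.
  by have [a E] := TM g h X; apply: (eq_twisted_point (a := a)).
have rho_reg g : regular phi (rho g).
  move=> P; have [F [homF FE]] := Trat g; exists 1%N, F; split=> [//||Q v].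
    have [X [nz_X ->]] := twisted_pointP P.
    exists (psi X); first exact: memv_line.
    by rewrite -[psi X]scale1r FE scale1r psi_neq0 ?nzT.
  have [X [nz_X ->]] := twisted_pointP Q; rewrite rhoE => /vlineP[b ->].
  by rewrite FE memvZ ?memv_line.
exists rho; split=> // [g|g h eq_gh].
  exists (rho g^-1%g); split=> // P; first by rewrite -[RHS]rho1 -(mulVg g) rhoM.
  by rewrite -[RHS]rho1 -(mulgV g) rhoM.
apply: Tinj => X; have [->|nz_X] := eqVneq X 0.
  by exists 0; rewrite -(scale0r 0) !TZ !scale0r.
have := eq_gh (twisted_point nz_X); rewrite !rhoE.
exact: twisted_point_inj.
Qed.

Definition monomial (u : 'I_q -> L) (b : 'I_q) (X : 'rV[L]_q) : 'rV[L]_q :=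
  \row_i (u i * X 0 (i - b)).

(** In the coordinates of [psi], a monomial matrix preserves s and acts on m by
    the Fourier transform of its entries u_i^(q-1) u_(i+s); the hypothesis is
    that this transform is over K. *)
Lemma monomial_rational (u : 'I_q -> L) (b : 'I_q) :
  (forall s m m' : 'I_q, exists k : K, phi k =
     \sum_(i < q) z ^+ (i * m) / z ^+ (i * m') * (alpha ^+ m / alpha ^+ m') *
       (u (i + b) ^+ q.-1 * u (i + b + s))) ->
  exists F : 'I_N -> {mpoly K[N]}, (forall h, F h \is 1.-homog) /\
     forall a X, eval_row phi F (a *: psi X) = a *: psi (monomial u b X).
Proof.
move=> rat.
have [k kE] := fin_all_exists (fun s => fin_all_exists (fun m =>
  fin_all_exists (rat s m))).
pose F (h : 'I_N) : {mpoly K[N]} := mxvec (\matrix_(s < q, m < q)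
  \sum_(m' < q) (zeta ^+ (b * m) * k s m m' / q%:R) *:
     'X_(mxvec_index s m')) 0 h.
exists F; split=> [h|a X].
  rewrite /F; case/mxvec_indexP: h => s m; rewrite mxvecE mxE.
  apply: rpred_sum => m' _; apply: dhomogZ.
  by rewrite dhomogX /= mdeg1.
set v := a *: psi X.
have vE i s : a * (X 0 i ^+ q.-1 * X 0 (i + s)) = (q%:R * theta ^+ s)^-1 *
    \sum_(m < q) (z ^+ (i * m) * alpha ^+ m)^-1 * vec_mx v s m.
  transitivity (untwist v i (i + s)).
    by rewrite /v /psi -twistZ twistK !mxE.
  by rewrite mxE addrAC subrr add0r.
have nz_ts (s : 'I_q) : theta ^+ s != 0 by exact: expf_neq0.
have nz_am (m : 'I_q) : alpha ^+ m != 0 by exact: expf_neq0.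
apply/rowP => h; rewrite mxE /F -twistZ.
case/mxvec_indexP: h => s m; rewrite !mxvecE [in LHS]mxE [RHS]mxE.
rewrite map_mpoly_sum meval_sum [in RHS](reindex_inj (addIr b)) mulr_sumr.
transitivity (\sum_(i < q) \sum_(m' < q) z ^+ (b * m) *
   (z ^+ (i * m) / z ^+ (i * m') * (alpha ^+ m / alpha ^+ m') *
       (u (i + b) ^+ q.-1 * u (i + b + s))) / q%:R * vec_mx v s m').
  rewrite exchange_big; apply: eq_bigr => m' _.
  rewrite map_mpolyZ map_mpolyX mevalZ mevalXU !rmorphM rmorphXn fmorphV.
  rewrite rmorph_nat kE mulr_sumr !mulr_suml.
  by apply: eq_bigr => i _; rewrite [vec_mx _ _ _]mxE.
apply: eq_bigr => i _; rewrite !mxE addrK [(i + b + s)%R]addrAC addrK.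
rewrite root_addl ?(prim_expr_order prim_z) //.
transitivity (alpha ^+ m * theta ^+ s * (z ^+ (i * m) * z ^+ (b * m) *
  (u (i + b) ^+ q.-1 * u (i + s + b))) *
   (a * (X 0 i ^+ q.-1 * X 0 (i + s)))); last first.
  by rewrite exprMn; ring.
rewrite vE !mulr_sumr; apply: eq_bigr => m' _.
move: (q%:R : L) qL_neq0 => Q nzQ.
by field; rewrite ?nzQ ?nz_ts ?nz_am ?zX_neq0.
Qed.

(** A K-morphism from projective space maps the point [1 : 0 : ... : 0] to a
    K-point. *)
Lemma twisted_rational_point :
  isomorphic phi twisted_set (predT : pred (pspace L q)) ->
  exists2 X : 'rV[L]_q, X != 0 & exists y : 'rV[K]_N, psi X = map_mx phi y.
Proof.
case=> _ [g [_ reg_g _ _]].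
pose e : 'rV[K]_q := delta_mx 0 0.
have nz_e : map_mx phi e != 0.
  rewrite map_mx_eq0; apply/eqP => /rowP/(_ ord0)/eqP.
  by rewrite !mxE eqxx oner_eq0.
pose P : points (predT : pred (pspace L q)) :=
  exist (fun P => is_true (predT P)) (pline nz_e) isT.
have [d [F [homF [v /vlineP[a ->] nz_Fv] FE]]] := reg_g P.
have Fe : eval_row phi F (map_mx phi e) = map_mx phi (\row_h (F h).@[e 0]).
  by apply/rowP => h; rewrite !mxE meval_map_mpoly.
have nz_Fe : eval_row phi F (map_mx phi e) != 0.
  apply: contraNneq nz_Fv => /rowP Fe0; apply/eqP/rowP => h.
  have := Fe0 h; rewrite !mxE => Fh0.
  rewrite (@homog_mevalZ _ _ d) ?Fh0 ?mulr0 //.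
  apply/dhomogP => m; rewrite mcoeff_msupp mcoeff_map_mpoly fmorph_eq0.
  by rewrite -mcoeff_msupp; exact: (dhomog_mf (homF h)).
have [X XE] := twisted_set_cone (valP (g P)) (FE P _ (memv_line _)).
exists X; last by exists (\row_h (F h).@[e 0]); rewrite -XE.
apply: contraNneq nz_Fe => X0.
by rewrite XE X0 -(scale0r 0) psiZ expr0n scale0r.
Qed.

(** At a point psi(X) over K, the coordinates with s = 0 and s = 1 give
    X_i^q and theta X_i^(q-1) X_(i+1), up to a factor q, as conjugates of two
    elements of K(alpha).  The products over i differ by the factor
    theta^q = t. *)
Lemma twisted_nontrivial :
  (forall y0 y1 : 'I_q -> K,
     \prod_(i < q) \sum_(m < q) (z ^+ i * alpha) ^- m * phi (y1 m) =
     phi t * \prod_(i < q) \sum_(m < q) (z ^+ i * alpha) ^- m * phi (y0 m) ->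
     forall i : 'I_q, \sum_(m < q) (z ^+ i * alpha) ^- m * phi (y0 m) = 0) ->
  nontrivial_severi_brauer q twisted_variety.
Proof.
move=> norm_t; split; first exact: twisted_severi_brauer.
case/twisted_rational_point=> X nz_X [y yE].
(* Fourier inversion along the s-th cyclic diagonal *)
have sumE (i s : 'I_q) :
    \sum_(m < q) (z ^+ i * alpha) ^- m * phi (y 0 (mxvec_index s m)) =
    q%:R * theta ^+ s * (X 0 i ^+ q.-1 * X 0 (i + s)).
  have -> : X 0 i ^+ q.-1 * X 0 (i + s) = untwist (psi X) i (i + s).
    by rewrite twistK !mxE.
  rewrite mxE addrAC subrr add0r mulVKf ?mulf_neq0 ?expf_neq0 //.
  by apply: eq_bigr => m _; rewrite yE !mxE exprMn exprM.
have := norm_t (fun m => y 0 (mxvec_index 0 m)) (fun m => y 0 (mxvec_index 1 m)).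
case/(_ _)/wrap=> [|X0].
  under eq_bigr => i _ do rewrite sumE.
  under [in RHS]eq_bigr => i _ do rewrite sumE addr0.
  rewrite !big_split !prodr_const !card_ord /= expr1 theta_q expr0 expr1n.
  rewrite -(reindex_inj (addIr 1) (P := xpredT) (F := fun i => X 0 i)) /=.
  by ring.
case/eqP: nz_X; apply/rowP => i; have := X0 i; rewrite sumE addr0 mxE.
by rewrite -exprSr expr0 mulr1 => /eqP; rewrite mulf_eq0 (negPf qL_neq0) expf_eq0 => /eqP.
Qed.

End TwistedVariety.

(** * The metacyclic groups acting on the twisted variety *)

Section MuGroupAction.
Variables (K : fieldType) (L : closedFieldType) (phi : {rmorphism K -> L}).
Variable q' : nat.
Local Notation q := q'.+2.
Variables (zeta c t : K) (alpha theta : L).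
Hypothesis prim_zeta : q.-primitive_root zeta.
Hypothesis q_neq0 : q%:R != 0 :> K.
Hypothesis alpha_q : alpha ^+ q = phi c.
Hypothesis theta_q : theta ^+ q = phi t.
Hypothesis alpha_neq0 : alpha != 0.
Hypothesis theta_neq0 : theta != 0.
Let X := twisted_variety prim_zeta q_neq0 alpha_q theta_q alpha_neq0 theta_neq0.

Variables (n : nat) (chi : mu_hom q n) (xi : L) (lam jj : nat).
Hypothesis n_gt0 : (0 < n)%N.
Hypothesis prim_xi : n.-primitive_root xi.
Hypothesis xi_period : xi ^+ (lam ^ q) = xi.
Hypothesis lam_gt0 : (0 < lam)%N.
Hypothesis co_lam : coprime (lam - 1) n.
Hypothesis co_nq : coprime n q.
Hypothesis co_qj : coprime q jj.
Hypothesis chiE : forall b : 'Z_q, (val (chi b) = lam ^ (jj * b) %[mod n])%N.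

Let z : L := phi zeta.
Let zq : z ^+ q = 1.
Proof. by rewrite /z -rmorphXn (prim_expr_order prim_zeta) rmorph1. Qed.
Let prim_z : q.-primitive_root z.
Proof. by rewrite /z fmorph_primitive_root. Qed.
Let z_neq0 : z != 0.
Proof.
by apply: contra_eq_neq zq => ->; rewrite expr0n eq_sym oner_neq0.
Qed.
Let xi_neq0 : xi != 0.
Proof.
apply: contra_eq_neq (prim_expr_order prim_xi) => ->.
by rewrite expr0n gtn_eqF // eq_sym oner_neq0.
Qed.

(** The conjugate of xi under the i-th power of the automorphism that raises xi
    to the power lam. *)
Definition xiconj (i : 'I_q) : L := xi ^+ (lam ^ i).

Hypothesis trace_rational : forall (s m m' : 'I_q) (x : nat), exists k : K,
  phi k = \sum_(i < q) z ^+ (i * m) / z ^+ (i * m') * (alpha ^+ m / alpha ^+ m')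
    * ((xiconj i ^+ x) ^+ q.-1 * xiconj (i + s) ^+ x).

Lemma xi_lam_mod e : xi ^+ (lam ^ (e %% q)) = xi ^+ (lam ^ e).
Proof.
have per k : xi ^+ (lam ^ (k * q)) = xi.
  elim: k => [|k IH]; first by rewrite expn0 expr1.
  by rewrite mulSn expnD exprM xi_period.
by rewrite [in RHS](divn_eq e q) expnD exprM per.
Qed.

(** For n = 1 the modulus of ['Z_n] is 2, which is harmless because xi = 1. *)
Lemma xi_Zp_mod e : xi ^+ (e %% (Zp_trunc n).+2) = xi ^+ e.
Proof.
apply: expr_mod; have [n_gt1|] := ltnP 1 n.
  by rewrite Zp_cast // (prim_expr_order prim_xi).
rewrite leq_eqVlt ltnS leqn0 eqn0Ngt n_gt0 orbF => /eqP n1.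
have := prim_expr_order prim_xi; rewrite {1}n1 expr1 => ->.
by rewrite expr1n.
Qed.

Lemma xi_chi (b : 'Z_q) : xi ^+ (val (chi b)) = xi ^+ (lam ^ (jj * b)).
Proof. by apply/eqP; rewrite (eq_prim_root_expr prim_xi); apply/eqP/chiE. Qed.

(** The element (a, (b, x)) acts by diag(xi^(lam^i))^x, then by the cyclic shift by
    jj b, then by diag(zeta^(ia)).  Conjugation by the shift multiplies the
    exponent x by lam^(jj b), that is, by chi(b). *)
Definition gact (g : mu_group chi) : 'rV[L]_q -> 'rV[L]_q :=
  let: (a, w) := g in let sh : 'I_q := (pair_of_sd w).1 *+ jj in
  monomial (fun i => z ^+ (i * (a : 'I_q)) *
                     xiconj (i - sh) ^+ ((pair_of_sd w).2)) sh.

Lemma gactE (a : 'Z_q) (w : sdprod_by (mu_groupAction chi)) Y (i : 'I_q) :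
  gact (a, w) Y 0 i = z ^+ (i * a) *
    xiconj (i - (pair_of_sd w).1 *+ jj) ^+ ((pair_of_sd w).2) *
    Y 0 (i - (pair_of_sd w).1 *+ jj).
Proof. by rewrite mxE. Qed.

Lemma gactE_pair (a b : 'Z_q) (x : 'Z_n) bx Y (i : 'I_q) :
  gact (a, SdPair (mu_groupAction chi) (ax := (b, x)) bx) Y 0 i =
  z ^+ (i * a) * xiconj (i - (b : 'I_q) *+ jj) ^+ x *
    Y 0 (i - (b : 'I_q) *+ jj).
Proof. by rewrite mxE. Qed.

Lemma xiconj_chi (i : 'I_q) (b : 'Z_q) (x : 'Z_n) :
  xiconj i ^+ (mu_act_fun chi x b : 'Z_n) = xiconj (i + (b : 'I_q) *+ jj) ^+ x.
Proof.
have -> : xiconj (i + (b : 'I_q) *+ jj) = xi ^+ (lam ^ (i + jj * b)).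
  rewrite -[RHS]xi_lam_mod /xiconj Zp_mulrn /= modnDmr.
  by rewrite [(b * jj)%N]mulnC.
rewrite /xiconj -exprM mulnC exprM /= xi_Zp_mod [(x * _)%N]mulnC.
rewrite [xi ^+ (_ * x)]exprM xi_chi -!exprM; congr (_ ^+ _).
by rewrite expnD; ring.
Qed.

Lemma gact_rational g : exists F : 'I_(q * q) -> {mpoly K[q * q]},
  (forall h, F h \is 1.-homog) /\
  forall a Y, eval_row phi F (a *: psi phi zeta alpha theta Y) =
              a *: psi phi zeta alpha theta (gact g Y).
Proof.
case: g => a w; apply: monomial_rational => // s m m'.
have [k kE] := trace_rational s m m' (pair_of_sd w).2.
exists (zeta ^+ (s * (a : 'I_q)) * k); rewrite rmorphM rmorphXn kE mulr_sumr.
apply: eq_bigr => i _; set sh := (pair_of_sd w).1 *+ jj.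
rewrite addrK [(i + sh + s)%R]addrAC addrK !root_addl //.
rewrite -/z.
set A := z ^+ (i * a); set B := z ^+ (sh * a); set C := z ^+ (s * a).
have AB : (A * B) ^+ q.-1 * (A * B) = 1.
  rewrite -exprSr exprMn -!exprM ![(_ * a * _)%N]mulnC !(exprM z q) zq !expr1n.
  by rewrite mulr1.
rewrite !exprMn in AB *.
transitivity ((A ^+ q.-1 * B ^+ q.-1 * (A * B)) * (C * (z ^+ (i * m) /
  z ^+ (i * m') * (alpha ^+ m / alpha ^+ m') *
  ((xiconj i ^+ (pair_of_sd w).2) ^+ q.-1 * xiconj (i + s) ^+ (pair_of_sd w).2)))).
  by rewrite AB mul1r.
by ring.
Qed.

Lemma gact_neq0 g Y : Y != 0 -> gact g Y != 0.
Proof.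
case: g => a w; apply: contraNneq => /rowP gY0; apply/eqP/rowP => i.
have := gY0 (i + (pair_of_sd w).1 *+ jj); rewrite gactE addrK !mxE.
by move/eqP; rewrite !mulf_eq0 !expf_eq0 (negPf z_neq0) (negPf xi_neq0) !andbF => /eqP.
Qed.

Lemma gactZ g a Y : gact g (a *: Y) = a *: gact g Y.
Proof.
by case: g => b w; apply/rowP => i; rewrite [RHS]mxE !gactE mxE mulrCA.
Qed.

Lemma gact1 Y : gact 1%g Y = Y.
Proof.
apply/rowP => i; rewrite gactE /= mul0rn subr0 muln0 !expr0 !mul1r.
by [].
Qed.

(** The diagonal matrices diag(zeta^i) commute with shifts only up to a power of
    zeta, whence the scalar. *)
Lemma gactM g h Y : exists a, gact g (gact h Y) = a *: gact (g * h)%g Y.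
Proof.
case: g h => [a [[b x] bx]] [a' [[b' x'] bx']].
pose sh : 'I_q := (b : 'I_q) *+ jj; pose sh' : 'I_q := (b' : 'I_q) *+ jj.
exists (z ^+ ((- sh)%R * (a' : 'I_q))%N); apply/rowP => i.
have [bx'' ->] : exists bx'',
    ((a, SdPair _ bx) * (a', SdPair _ bx'))%g = ((a + a')%R,
      SdPair (mu_groupAction chi)
        (ax := ((b + b')%R, (mu_act_fun chi x b' + x')%R)) bx'') :> mu_group chi.
  by eexists.
rewrite [RHS]mxE !gactE_pair mulrnDl -/sh -/sh' opprD addrA.
set i' := (i - sh - sh')%R.
have -> : xiconj i' ^+ ((mu_act_fun chi x b' + x')%R : 'Z_n) =
    xiconj (i - sh) ^+ x * xiconj i' ^+ x'.
  have -> : (i - sh = i' + sh')%R by rewrite /i' subrK.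
  rewrite -xiconj_chi -exprD /xiconj /= -!exprM mulnC exprM xi_Zp_mod.
  by rewrite -exprM mulnC.
have -> : z ^+ (i * (a + a')%R) = z ^+ (i * a) * z ^+ (i * a').
  by rewrite mulnC root_addl // ![(_ * i)%N]mulnC.
rewrite root_addl //; ring.
Qed.

(** The image of a coordinate point determines the shift.  Comparing two adjacent
    entries of the image of (1, ..., 1) gives zeta^a xi^((lam-1)x), and the two
    factors have coprime orders; xi^(lam-1) still has order n. *)
Lemma gact_inj g h : (forall Y, exists a, gact g Y = a *: gact h Y) -> g = h.
Proof.
case: g h => [a [[b x] bx]] [a' [[b' x'] bx']] gh.
pose sh : 'I_q := (b : 'I_q) *+ jj; pose sh' : 'I_q := (b' : 'I_q) *+ jj.
have nz_xi (i : 'I_q) e : xiconj i ^+ e != 0 by rewrite !expf_neq0.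
have eq_sh : sh = sh'.
  have [k kE] := gh (delta_mx 0 0); have := congr1 (fun Y : 'rV_q => Y 0 sh) kE.
  rewrite [RHS]mxE !gactE_pair -/sh -/sh' subrr !mxE eqxx mulr1.
  case: (altP (sh - sh' =P 0)) => [/eqP|_ /eqP]; first by rewrite subr_eq0 => /eqP.
  by rewrite !mulr0 mulf_eq0 (negPf (nz_xi _ _)) expf_eq0 (negPf z_neq0) andbF.
have eq_b : b = b'.
  have prim_zj : q.-primitive_root (z ^+ jj).
    by rewrite prim_root_exp_coprime // coprime_sym.
  have zsh (d : 'I_q) : z ^+ (d *+ jj)%R = (z ^+ jj) ^+ d.
    by rewrite Zp_mulrn /= (prim_expr_mod prim_z) mulnC exprM.
  have /eqP : (z ^+ jj) ^+ (b : 'I_q) = (z ^+ jj) ^+ (b' : 'I_q).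
    by rewrite -!zsh -/sh -/sh' eq_sh.
  rewrite (eq_prim_root_expr prim_zj) !modn_small; try exact: ltn_ord.
  by move/eqP/val_inj.
have [k kE] := gh (const_mx 1).
have kE' i := congr1 (fun Y : 'rV_q => Y 0 (i + sh)) kE.
have {}kE i : z ^+ ((i + sh)%R * a) * xiconj i ^+ x =
    k * (z ^+ ((i + sh)%R * a') * xiconj i ^+ x').
  have := kE' i; rewrite [RHS]mxE !gactE_pair -/sh -/sh' -eq_sh addrK !mxE.
  by rewrite !mulr1.
have k1 : z ^+ (a : 'I_q) * (xi ^+ (lam - 1)) ^+ x =
          z ^+ (a' : 'I_q) * (xi ^+ (lam - 1)) ^+ x'.
  have := kE 0; have := kE 1; rewrite !add0r !root_addl // !mul1n.
  have -> : xiconj 0 = xi by rewrite /xiconj expr1.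
  have -> : xiconj 1 = xi * xi ^+ (lam - 1).
    by rewrite /xiconj /= modn_small // expn1 -exprS subn1 prednK.
  move=> k1 k0; have nz : z ^+ (sh * a) * xi ^+ x != 0.
    by rewrite mulf_neq0 ?expf_neq0.
  apply: (mulfI nz); rewrite {2}k0; move: k1; rewrite !exprMn => k1.
  transitivity (z ^+ (a : 'I_q) * z ^+ (sh * a) *
                (xi ^+ x * (xi ^+ (lam - 1)) ^+ x)); first by ring.
  by rewrite k1; ring.
have prim_xl : n.-primitive_root (xi ^+ (lam - 1)).
  by rewrite prim_root_exp_coprime.
have eq_a : a = a'.
  have prim_zn : q.-primitive_root (z ^+ n) by rewrite prim_root_exp_coprime.
  have := congr1 (fun u => u ^+ n) k1.
  rewrite !exprMn !(exprAC (xi ^+ (lam - 1)) _ n) (prim_expr_order prim_xl).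
  rewrite !expr1n !mulr1 !(exprAC z _ n).
  move/eqP; rewrite (eq_prim_root_expr prim_zn) !modn_small; try exact: ltn_ord.
  by move/eqP/val_inj.
have eq_x : x = x'.
  have [n_gt1|n_le1] := ltnP 1 n; last first.
    have Zpn u : u \in Zp n -> u = 0 by rewrite /Zp ltnNge n_le1 => /set1P.
    have /setXP[_ /Zpn x0] := bx; have /setXP[_ /Zpn x'0] := bx'.
    by transitivity (0 : 'Z_n).
  have nE : (Zp_trunc n).+2 = n := Zp_cast n_gt1.
  move: k1; rewrite eq_a => /(mulfI (expf_neq0 _ z_neq0))/eqP.
  rewrite (eq_prim_root_expr prim_xl) !modn_small; first by move/eqP/val_inj.
  - by rewrite -[X in (_ < X)%N]nE ltn_ord.
  by rewrite -[X in (_ < X)%N]nE ltn_ord.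
subst; congr (_, _); congr SdPair; exact: bool_irrelevance.
Qed.

Lemma mu_group_Aut : Aut_contains X (mu_group chi).
Proof.
apply: twisted_Aut_contains gactZ gact_neq0 gact1 gactM gact_inj gact_rational.
Qed.
End MuGroupAction.

(** * Subfields, fraction fields and algebraic closures *)

Section Subfield.
Variables (F : fieldType) (S : divringClosed F).

Record subfield_of := Subfield { subfield_val : F; _ : subfield_val \in S }.

HB.instance Definition _ := [isSub for subfield_val].
HB.instance Definition _ := [Choice of subfield_of by <:].
HB.instance Definition _ := [SubChoice_isSubIntegralDomain of subfield_of by <:].
HB.instance Definition _ := [SubIntegralDomain_isSubField of subfield_of by <:].

End Subfield.

Lemma subfield_exists (F : fieldType) (S : {pred F}) : divring_closed S ->
  exists (k : fieldType) (j : {rmorphism k -> F}),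
    forall x, x \in S <-> exists y, j y = x.
Proof.
move=> clS; pose S' : divringClosed F := HB.pack (S : pred F)
  (GRing.isDivringClosed.Build F S clS).
exists (subfield_of S'), (val : {rmorphism subfield_of S' -> F}) => x.
by split=> [Sx|[y <-]]; [exists (Subfield (S := S') Sx) | exact: (valP y)].
Qed.

Section FractionField.
Local Open Scope quotient_scope.
Variable R : idomainType.

Lemma fraction_numden (x : {fraction R}) :
  x = tofrac (\n_(repr x)) / tofrac (\d_(repr x)).
Proof.
have nz_d : tofrac (\d_(repr x)) != 0 by rewrite tofrac_eq0 denom_ratioP.
apply: (canRL (mulfK nz_d)); rewrite -{1}[x]reprK.
move: (repr x) => r.
rewrite !piE; apply/eqmodP; rewrite /= equivfE /FracField.mulf.
by rewrite !numden_Ratio ?mulf_neq0 ?oner_eq0 ?denom_ratioP // mulr1 mulr1 mulrC.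
Qed.

Lemma fraction_lift (F : fieldType) (f : {rmorphism R -> F}) : injective f ->
  exists g : {rmorphism {fraction R} -> F}, forall a, g (tofrac a) = f a.
Proof.
move=> inj_f; have nz_f (d : R) : d != 0 -> f d != 0.
  by move=> nz_d; rewrite -(inj_eq inj_f) rmorph0 in nz_d.
pose g (x : {fraction R}) := f (\n_(repr x)) / f (\d_(repr x)).
have gE n d (x : {fraction R}) : d != 0 -> x * tofrac d = tofrac n -> g x * f d = f n.
  move=> nz_d; rewrite {1}(fraction_numden x).
  set n' := \n_(repr x); set d' := \d_(repr x) => E.
  have nz_d' : d' != 0 by exact: denom_ratioP.
  have : n' * d = n * d'.
    apply/eqP; rewrite -tofrac_eq !rmorphM /= -E mulrAC mulfVK //.
    by rewrite tofrac_eq0.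
  by move/(congr1 f); rewrite !rmorphM /g -/n' -/d' mulrAC => ->; rewrite mulfK ?nz_f.
have rep (x : {fraction R}) : exists n d, d != 0 /\ x * tofrac d = tofrac n.
  exists (\n_(repr x)), (\d_(repr x)); split; first exact: denom_ratioP.
  by rewrite {1}(fraction_numden x) mulfVK // tofrac_eq0 denom_ratioP.
have gB : zmod_morphism g.
  move=> x y; have [n [d [nz_d xE]]] := rep x; have [n' [d' [nz_d' yE]]] := rep y.
  have nz : f d * f d' != 0 by rewrite mulf_neq0 ?nz_f.
  apply: (mulIf nz); rewrite -rmorphM (gE (n * d' - n' * d)) ?mulf_neq0 //.
    rewrite rmorphB !rmorphM /= -(gE _ _ _ nz_d xE) -(gE _ _ _ nz_d' yE).
    by ring.
  by rewrite rmorphB !rmorphM /= -xE -yE; ring.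
have gM : monoid_morphism g.
  split=> [|x y].
    by have := gE 1 1 1 (oner_neq0 _) (mul1r _); rewrite rmorph1 mulr1.
  have [n [d [nz_d xE]]] := rep x; have [n' [d' [nz_d' yE]]] := rep y.
  have nz : f d * f d' != 0 by rewrite mulf_neq0 ?nz_f.
  apply: (mulIf nz); rewrite -rmorphM (gE (n * n')) ?mulf_neq0 //.
    by rewrite !rmorphM /= -(gE _ _ _ nz_d xE) -(gE _ _ _ nz_d' yE); ring.
  by rewrite !rmorphM /= -xE -yE; ring.
pose gz := GRing.isZmodMorphism.Build _ _ g gB.
pose gm := GRing.isMonoidMorphism.Build _ _ g gM.
pose gr : {rmorphism {fraction R} -> F} := HB.pack g gz gm.
exists gr => a /=.
rewrite -[LHS]mulr1 -(rmorph1 f); apply: gE; first exact: oner_neq0.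
by rewrite rmorph1 mulr1.
Qed.

End FractionField.

Lemma countable_fraction_closure (R : countIdomainType) :
  exists (L : closedFieldType) (f : {rmorphism {fraction R} -> L}),
    integralRange f.
Proof.
pose cr := [Countable of {ratio R} by <:].
pose ratioC : countType := HB.pack {ratio R} cr.
pose cf := isCountable.Build {fraction R}
  (pcan_pickleK (can_pcan (reprK : cancel (repr : {fraction R} -> ratioC) _))).
pose FC : countFieldType := HB.pack {fraction R} cf.
have [L [f int_f]] := countable_algebraic_closure FC.
by exists L, f.
Qed.

(** An element is encoded by a monic polynomial over F that it annihilates and by
    its index in a list of the roots. *)
Lemma algebraic_countable (F : countFieldType) (E : closedFieldType)
    (iota : {rmorphism F -> E}) : integralRange iota ->
  exists (g : E -> {poly F} * nat) g', cancel g g'.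
Proof.
move=> int_i; pose roots p := sval (closed_field_poly_normal (map_poly iota p)).
have rootsP p x : p \is monic -> root (map_poly iota p) x -> x \in roots p.
  move=> mon_p; rewrite /roots; case: closed_field_poly_normal => r /= ->.
  rewrite lead_coef_map (monicP mon_p) rmorph1 scale1r.
  by rewrite root_prod_XsubC.
have ex x : exists p, (p \is monic) && root (map_poly iota p) x.
  by have [p mp px] := int_i x; exists p; rewrite mp.
exists (fun x => (xchoose (ex x), index x (roots (xchoose (ex x))))).
exists (fun pi => nth 0 (roots pi.1) pi.2) => x /=.
by have /andP[mp px] := xchooseP (ex x); rewrite nth_index ?rootsP.
Qed.

(** The construction of an algebraic closure by adjoining roots one after the other
    enumerates the field; E is countable because F is. *)
Lemma rational_function_closure (F : countFieldType) (E : closedFieldType)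
    (iota : {rmorphism F -> E}) : integralRange iota ->
  exists (L : closedFieldType) (f : {rmorphism {fraction {poly E}} -> L}),
    integralRange f.
Proof.
move=> int_i; have [g [g' gK]] := algebraic_countable int_i.
pose cE := isCountable.Build E (pcan_pickleK (can_pcan gK)).
pose EC : countFieldType := HB.pack (E : Type) (GRing.Field.on E) cE.
exact: (countable_fraction_closure {poly EC}).
Qed.

(** Since E is algebraic over k, the field E(t) is algebraic over k(t): an
    algebraic closure of the former is one of the latter. *)
Lemma rational_function_subfield_closure (F k E L : fieldType)
    (iota : {rmorphism F -> E}) (j : {rmorphism k -> E})
    (f : {rmorphism {fraction {poly E}} -> L}) :
  integralRange iota -> (forall a, exists b, j b = iota a) -> integralRange f ->
  exists2 kappa : {rmorphism {fraction {poly k}} -> L},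
    integralRange kappa &
    forall p, kappa (tofrac p) = f (tofrac (map_poly j p)).
Proof.
move=> int_i ij int_f.
pose h : {rmorphism {poly k} -> L} := f \o @tofrac _ \o map_poly j.
have inj_h : injective h.
  move=> p p' /fmorph_inj/eqP; rewrite tofrac_eq => /eqP.
  exact: map_poly_inj.
have [kappa kE] := fraction_lift inj_h; exists kappa; last exact: kE.
pose c (x : E) : L := f (tofrac x%:P).
have int_jc b : integralOver kappa (c (j b)).
  by rewrite /c -(map_polyC j) -[f _]/(h b%:P) -kE; apply: integral_id.
have int_c x : integralOver kappa (c x).
  have [p mon_p px] := int_i x.
  pose cm : {rmorphism E -> L} := f \o @tofrac _ \o @polyC E.
  apply: (integral_root_monic (p := map_poly (cm \o iota) p)).
  - by rewrite map_monic.
  - by rewrite map_poly_comp -[c x]/(cm x) fmorph_root.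
  apply/integral_poly => i; rewrite coef_map /=.
  by have [b <-] := ij p`_i; apply: int_jc.
have int_t : integralOver kappa (f (tofrac 'X)).
  by rewrite -(map_polyX j) -[f _]/(h 'X) -kE; apply: integral_id.
have int_p (p : {poly E}) : integralOver kappa (f (tofrac p)).
  elim/poly_ind: p => [|p x IHp]; first by rewrite !rmorph0; apply: integral0.
  rewrite !rmorphD !rmorphM; apply: integral_add; last exact: int_c.
  exact: integral_mul.
have int_fr x : integralOver kappa (f x).
  by rewrite (fraction_numden x) fmorph_div; apply: integral_div.
move=> w; have [p mon_p pw] := int_f w.
apply: (integral_root_monic (p := map_poly f p)) => //.
  by rewrite map_monic.
by apply/integral_poly => i; rewrite coef_map; exact: int_fr.
Qed.

(** * Roots of unity and Kummer elements *)

Lemma closed_prim_root_exists (E : closedFieldType) (n : nat) :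
  n%:R != 0 :> E -> exists w : E, n.-primitive_root w.
Proof.
move=> nz_n; have n_gt0 : (0 < n)%N by case: n nz_n => //; rewrite eqxx.
have [r rE] := closed_field_poly_normal ('X^n - 1 : {poly E}).
have mon : 'X^n - 1 \is @monic E by rewrite monicXnsubC.
rewrite (monicP mon) scale1r in rE.
have uniq_r : uniq r by rewrite -separable_prod_XsubC -rE separable_Xn_sub_1.
have size_r : size r = n.
  by apply: succn_inj; rewrite -(size_prod_XsubC r id) -rE size_XnsubC.
have /hasP[w _ prim_w] : has n.-primitive_root r.
  apply: has_prim_root => //; last by rewrite size_r.
  apply/allP => x rx; rewrite unity_rootE -subr_eq0.
  have : root ('X^n - 1) x by rewrite rE root_prod_XsubC.
  by rewrite rootE !hornerE.
by exists w.
Qed.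

Lemma prime_prim_root (R : nzRingType) (p : nat) (w : R) :
  prime p -> w ^+ p = 1 -> w != 1 -> p.-primitive_root w.
Proof.
move=> pr_p wp w1; have [d prim_w] := prim_order_exists (prime_gt0 pr_p) wp.
case/primeP: pr_p => _ dp /dp/orP[] /eqP d1; last by rewrite -d1.
by move: (prim_expr_order prim_w) w1; rewrite d1 expr1 => ->; rewrite eqxx.
Qed.

(** For prime q, the powers beta^i with i < q of a Kummer generator are
    independent.  The gcd of p and X^q - b has between 1 and q - 1 of the roots
    z^i beta, so its constant term gives a power beta^s in k with s prime to q;
    together with beta^q this puts beta in k. *)
Lemma Kummer_independence (k E : fieldType) (j : {rmorphism k -> E}) (q : nat)
    (z b : k) (beta : E) (p : {poly k}) :
  prime q -> q.-primitive_root z -> beta ^+ q = j b ->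
  (forall y, j y != beta) ->
  (size p <= q)%N -> root (map_poly j p) beta -> p = 0.
Proof.
move=> pr_q prim_z betaq nbeta size_p root_p; apply/eqP/negPn/negP => nz_p.
have q_gt0 := prime_gt0 pr_q.
have prim_jz : q.-primitive_root (j z) by rewrite fmorph_primitive_root.
have nz_beta : beta != 0.
  by apply/eqP => beta0; have := nbeta 0; rewrite rmorph0 beta0 eqxx.
pose g := gcdp p ('X^q - b%:P).
have jb : map_poly j ('X^q - b%:P) = 'X^q - (beta ^+ q)%:P.
  by rewrite rmorphB /= map_polyXn map_polyC /= -betaq.
have root_g : root (map_poly j g) beta.
  by rewrite gcdp_map root_gcd root_p jb rootE !hornerE subrr.
have nz_g : g != 0 by rewrite gcdp_eq0 negb_and nz_p.
have size_g : (size g <= q)%N.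
  by apply: leq_trans size_p; rewrite dvdp_leq ?dvdp_gcdl.
pose zb i := j z ^+ i * beta.
have XqE : 'X^q - (beta ^+ q)%:P = \prod_(x <- map zb (iota 0 q)) ('X - x%:P).
  have mon : 'X^q - (beta ^+ q)%:P \is @monic E by rewrite monicXnsubC.
  rewrite -[RHS]scale1r -(monicP mon); apply: all_roots_prod_XsubC.
  - by rewrite size_map size_iota size_XnsubC.
  - apply/allP => _ /mapP[i _ ->]; rewrite rootE !hornerE exprMn -exprM mulnC.
    by rewrite exprM (prim_expr_order prim_jz) expr1n mul1r subrr.
  rewrite uniq_rootsE map_inj_in_uniq ?iota_uniq // => i i'.
  rewrite !mem_iota !add0n => /andP[_ lti] /andP[_ lti'] /(mulIf nz_beta)/eqP.
  by rewrite (eq_prim_root_expr prim_jz) !modn_small // => /eqP.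
have : map_poly j g %| \prod_(x <- map zb (iota 0 q)) ('X - x%:P).
  by rewrite -XqE -jb dvdp_map dvdp_gcdr.
case/dvdp_prod_XsubC=> m; rewrite -map_mask; set s := mask m _ => gE.
have prodE (t : seq nat) : exists e,
    (\prod_(x <- map zb t) ('X - x%:P)).[0] =
    (-1) ^+ size t * j z ^+ e * beta ^+ size t.
  elim: t => [|i t [e IH]]; first by exists 0%N; rewrite big_nil hornerC !mulr1.
  exists (i + e)%N; rewrite big_cons hornerM IH !hornerE /= !exprS exprD /zb.
  by ring.
have size_s : size g = (size s).+1.
  have := eqp_size gE; rewrite size_map_poly => ->.
  by rewrite size_prod_XsubC size_map.
have [y yE] : exists y, beta ^+ size s = j y.
  have /eqpP[[c1 c2] /= /andP[nz1 nz2] cE] := gE.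
  have := congr1 lead_coef cE; rewrite !lead_coefZ lead_coef_map.
  rewrite (monicP (monic_prod_XsubC _ _ _)) mulr1 => c2E.
  have [e eE] := prodE s; have := congr1 (horner^~ 0) cE.
  rewrite /= !hornerZ eE -c2E -[c1 * _ * _]mulrA => /(mulfI nz1).
  rewrite -[X in _.[X]](rmorph0 j) horner_map => gs.
  have nz_u : lead_coef g * ((-1) ^+ size s * z ^+ e) != 0.
    rewrite !mulf_neq0 ?lead_coef_eq0 ?expf_neq0 ?oppr_eq0 ?oner_eq0 //.
    by apply: contra_eq_neq (prim_expr_order prim_z) => ->;
       rewrite expr0n gtn_eqF // eq_sym oner_neq0.
  exists (g.[0] / (lead_coef g * ((-1) ^+ size s * z ^+ e))).
  apply: (mulIf (_ : j (lead_coef g * ((-1) ^+ size s * z ^+ e)) != 0)).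
    by rewrite fmorph_eq0.
  rewrite -rmorphM divfK // gs !rmorphM !rmorphXn rmorphN rmorph1.
  by ring.
have co : coprime q (size s).
  rewrite prime_coprime // gtnNdvd //; last by rewrite -ltnS -size_s.
  rewrite lt0n size_eq0; apply: contraTneq root_g => s0.
  have : size (map_poly j g) == 1%N by rewrite size_map_poly size_s s0.
  by case/size_poly1P => a nz_a ->; rewrite rootC.
have s_gt0 : (0 < size s)%N by case: (size s) co => //; rewrite /coprime gcdn0; case: (q) pr_q => [|[]].
case: (egcdnP q s_gt0) => u v uv _.
have := nbeta (y ^+ u / b ^+ v); case/eqP.
rewrite rmorphM fmorphV !rmorphXn -yE -betaq -!exprM mulnC uv.
rewrite (eqP (_ : gcdn (size s) q == 1%N)); last by rewrite gcdnC.
by rewrite exprD expr1 mulrC (mulnC v) mulKf // expf_neq0.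
Qed.

(** * The variable t is not a norm *)

(** No cancellation of leading terms: the coefficients of the highest power of t
    are combined by independent powers of a Kummer generator.  The degree is
    thus the same for all the conjugates i. *)
Lemma size_conjugate_comb (k E : fieldType) (j : {rmorphism k -> E}) (q : nat)
    (z b : k) (beta : E) (a : 'I_q -> {poly k}) (i : nat) :
  prime q -> q.-primitive_root z -> beta ^+ q = j b -> (forall y, j y != beta) ->
  size (\sum_(m < q) ((j z ^+ i * beta) ^- m) *: map_poly j (a m)) =
  \max_m size (a m).
Proof.
move=> pr_q prim_z betaq nbeta; set d := \max_m _; set A := \sum_(m < q) _.
have nz_beta : beta != 0.
  by apply/eqP => beta0; have := nbeta 0; rewrite rmorph0 beta0 eqxx.
have nz_z : z != 0.
  apply: contra_eq_neq (prim_expr_order prim_z) => ->.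
  by rewrite expr0n gtn_eqF ?prime_gt0 // eq_sym oner_neq0.
have le_d : (size A <= d)%N.
  apply: leq_trans (size_sum _ _ _) _; apply/bigmax_leqP => m _.
  apply: leq_trans (size_scale_leq _ _) _; rewrite size_map_poly.
  exact: (leq_bigmax m).
apply/eqP; rewrite eqn_leq le_d /=.
case d0 : d => [//|d']; rewrite ltnNge; apply/negP => le_d'.
have coefA : root (map_poly j (\poly_(m < q) (if insub m is Some m' then (a m')`_d' else 0)))
    (j z ^+ i * beta)^-1.
  rewrite rootE (@horner_coef_wide _ q); last first.
    by rewrite size_map_poly size_poly.
  rewrite (eq_bigr (fun m : 'I_q => (j z ^+ i * beta) ^- m * j (a m)`_d')).
    apply/eqP; rewrite -[RHS](nth_default 0 le_d') /A coef_sum.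
    by apply: eq_bigr => m _; rewrite coefZ coef_map.
  by move=> m _; rewrite coef_map coef_poly ltn_ord valK /= mulrC exprVn.
have := Kummer_independence pr_q prim_z _ _ _ coefA.
have -> : ((j z ^+ i * beta)^-1) ^+ q = j b^-1.
  rewrite exprVn exprMn -exprM mulnC exprM -rmorphXn (prim_expr_order prim_z).
  by rewrite rmorph1 expr1n mul1r betaq fmorphV.
move=> /(_ _ erefl) P0.
have {}P0 : \poly_(m < q) (if insub m is Some m' then (a m')`_d' else 0) = 0 :> {poly k}.
  apply: P0; last exact: size_poly.
  move=> y; apply/eqP => yE; have := nbeta (y^-1 / z ^+ i); case/eqP.
  rewrite rmorphM !fmorphV rmorphXn yE invrK mulrC mulKf //.
  by rewrite expf_neq0 ?fmorph_eq0.
have card_q : (0 < #|'I_q|)%N by rewrite card_ord prime_gt0.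
have [m mE] := eq_bigmax (fun m : 'I_q => size (a m)) card_q.
have := congr1 (fun p : {poly k} => p`_m) P0; rewrite coef_poly ltn_ord valK coef0.
have -> : d' = (size (a m)).-1 by rewrite -mE -/d d0.
move/eqP; rewrite -lead_coefE lead_coef_eq0 => /eqP am0.
by move: d0; rewrite /d mE am0 size_poly0.
Qed.


(** Both products have degree divisible by q, as their q factors are conjugate. *)
Lemma X_not_norm_ratio (k E : fieldType) (j : {rmorphism k -> E}) (q : nat)
    (z b : k) (beta : E) (u v : 'I_q -> {poly k}) :
  prime q -> q.-primitive_root z -> beta ^+ q = j b -> (forall y, j y != beta) ->
  \prod_(i < q) \sum_(m < q) ((j z ^+ i * beta) ^- m) *: map_poly j (v m) =
  'X * \prod_(i < q) \sum_(m < q) ((j z ^+ i * beta) ^- m) *: map_poly j (u m) ->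
  forall i : 'I_q, \sum_(m < q) ((j z ^+ i * beta) ^- m) *: map_poly j (u m) = 0.
Proof.
move=> pr_q prim_z betaq nbeta.
pose N (w : 'I_q -> {poly k}) (i : 'I_q) :=
  \sum_(m < q) ((j z ^+ i * beta) ^- m) *: map_poly j (w m).
rewrite -![\prod_(i < q) _]/(\prod_(i < q) N _ i) => normX i; apply/eqP.
rewrite -[X in X == 0]/(N u i); apply/negPn/negP => nz_i.
have sizeN w i' : size (N w i') = \max_m size (w m).
  exact: (size_conjugate_comb w i' pr_q prim_z betaq nbeta).
have nzN w i1 i2 : N w i1 != 0 -> N w i2 != 0.
  by rewrite -!size_poly_gt0 !sizeN.
have nz_u i' : N u i' != 0 by exact: nzN nz_i.
have nz_pu : \prod_(i < q) N u i != 0 by apply/prodf_neq0.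
have nz_v i' : N v i' != 0.
  have : \prod_(i < q) N v i != 0 by rewrite normX mulf_neq0 // polyX_eq0.
  by move/prodf_neq0/(_ i' isT).
have size_prodN w : (forall i, N w i != 0) ->
    size (\prod_(i < q) N w i) = ((q * \max_m size (w m)).+1 - q)%N.
  move=> nz_w; rewrite size_prod // card_ord.
  by rewrite (eq_bigr _ (fun i _ => sizeN w i)) sum_nat_const card_ord.
have := congr1 (fun p : {poly E} => size p) normX.
rewrite mulrC size_mulX // !size_prodN //.
have pos w : N w i != 0 -> (0 < \max_m size (w m))%N.
  by rewrite -size_poly_gt0 sizeN.
have le w : N w i != 0 -> (q <= (q * \max_m size (w m)).+1)%N.
  by move/pos => m_gt0; apply: leqW; rewrite -{1}[q]muln1 leq_mul2l m_gt0 orbT.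
move/(congr1 (addn^~ q)); rewrite addSn !subnK ?le //.
move=> /succn_inj eq_qd; have : (q %| (q * \max_m size (u m)).+1)%N.
  by rewrite -eq_qd dvdn_mulr.
by rewrite -addn1 dvdn_addr ?dvdn_mulr // dvdn1 => /eqP q1; rewrite q1 in pr_q.
Qed.

Lemma common_denominator (R : idomainType) (I : finType) (x : I -> {fraction R}) :
  exists2 d, d != 0 & exists n, forall i, x i * tofrac d = tofrac (n i).
Proof.
exists (\prod_i \d_(repr (x i))%qT).
  by apply/prodf_neq0 => i _; apply: denom_ratioP.
exists (fun i => \n_(repr (x i)) * \prod_(i' | i' != i) \d_(repr (x i'))) => i.
rewrite (bigD1 i) //= !rmorphM mulrA {1}(fraction_numden (x i)) divfK //.
by rewrite tofrac_eq0 denom_ratioP.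
Qed.

Lemma t_not_norm (k E L : fieldType) (j : {rmorphism k -> E})
    (f : {rmorphism {fraction {poly E}} -> L})
    (kappa : {rmorphism {fraction {poly k}} -> L}) (q : nat)
    (z b : k) (beta : E) (y0 y1 : 'I_q -> {fraction {poly k}}) :
  (forall p, kappa (tofrac p) = f (tofrac (map_poly j p))) ->
  prime q -> q.-primitive_root z -> beta ^+ q = j b -> (forall y, j y != beta) ->
  let w (i : nat) := kappa (tofrac z%:P) ^+ i * f (tofrac beta%:P) in
  \prod_(i < q) \sum_(m < q) w i ^- m * kappa (y1 m) =
    kappa (tofrac 'X) * \prod_(i < q) \sum_(m < q) w i ^- m * kappa (y0 m) ->
  forall i : 'I_q, \sum_(m < q) w i ^- m * kappa (y0 m) = 0.
Proof.
move=> kappaE pr_q prim_z betaq nbeta w normt.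
have [d nz_d [n nE]] := common_denominator (fun s : 'I_q + 'I_q =>
  match s with inl m => y0 m | inr m => y1 m end).
pose D := kappa (tofrac d).
have nz_D : D != 0 by rewrite fmorph_eq0 tofrac_eq0.
pose h : {rmorphism {poly E} -> L} := f \o @tofrac _.
have inj_h : injective h by move=> p p' /fmorph_inj/eqP; rewrite tofrac_eq => /eqP.
have wE i m : w i ^- m = h ((j z ^+ i * beta) ^- m)%:P.
  pose cm : {rmorphism E -> L} := h \o @polyC E.
  rewrite /w kappaE map_polyC -[RHS]/(cm ((j z ^+ i * beta) ^- m)).
  by rewrite fmorphV [in RHS]rmorphXn [in RHS]rmorphM [in RHS]rmorphXn.
pose N (u : 'I_q -> {poly k}) (i : nat) :=
  \sum_(m < q) ((j z ^+ i * beta) ^- m) *: map_poly j (u m).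
have NE (y : 'I_q -> {fraction {poly k}}) u i :
    (forall m, y m * tofrac d = tofrac (u m)) ->
    (\sum_(m < q) w i ^- m * kappa (y m)) * D = h (N u i).
  move=> yE; rewrite mulr_suml rmorph_sum; apply: eq_bigr => m _.
  by rewrite -mulrA -rmorphM yE kappaE wE -mul_polyC rmorphM.
have prodN y u : (forall m, y m * tofrac d = tofrac (u m)) ->
    (\prod_(i < q) \sum_(m < q) w i ^- m * kappa (y m)) * D ^+ q =
    h (\prod_(i < q) N u i).
  move=> yE; rewrite -[X in D ^+ X]card_ord -prodr_const -big_split rmorph_prod.
  by apply: eq_bigr => i _; apply: NE.
move=> i; apply: (mulIf nz_D).
rewrite mul0r (NE _ (fun m => n (inl m))); last by move=> m; apply: (nE (inl m)).
rewrite -(rmorph0 h); congr (h _).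
apply: (X_not_norm_ratio (v := fun m => n (inr m)) pr_q prim_z betaq nbeta).
apply: inj_h; rewrite [RHS]rmorphM.
apply: etrans (esym (prodN y1 _ (fun m => nE (inr m)))) _.
apply: etrans _ (congr1 ( *%R (h 'X)) (prodN y0 _ (fun m => nE (inl m)))).
by rewrite normt mulrA kappaE map_polyX.
Qed.

(** * Frobenius and the field of constants *)

Section Frobenius.
Variables (l : nat) (E : closedFieldType) (io : {rmorphism 'F_l -> E}).
Hypotheses (pr_l : prime l) (int_io : integralRange io).

Let pchar_E : l \in [pchar E].
Proof. by rewrite (fmorph_pchar io) pchar_Fp. Qed.

Definition frob (m : nat) (x : E) : E := x ^+ (l ^ m).

Lemma frobB m : {morph frob m : x y / x - y}.
Proof.
move=> x y; rewrite /frob; elim: m => [|m IH]; first by rewrite !expr1.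
rewrite expnSr !exprM IH -!(pFrobenius_autE pchar_E).
exact: rmorphB.
Qed.

Lemma frobD m : {morph frob m : x y / x + y}.
Proof.
move=> x y; rewrite /frob; elim: m => [|m IH]; first by rewrite !expr1.
rewrite expnSr !exprM IH -!(pFrobenius_autE pchar_E).
exact: rmorphD.
Qed.

Lemma frob0 m : frob m 0 = 0.
Proof. by rewrite /frob expr0n expn_eq0 eqn0Ngt prime_gt0. Qed.

Lemma frobM m : {morph frob m : x y / x * y}.
Proof. by move=> x y; rewrite /frob exprMn. Qed.

Lemma frobV m x : frob m x^-1 = (frob m x)^-1.
Proof. by rewrite /frob exprVn. Qed.

Lemma frob_inj m : injective (frob m).
Proof.
move=> x y /eqP; rewrite -subr_eq0 -frobB /frob expf_eq0 => /andP[_].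
by rewrite subr_eq0 => /eqP.
Qed.

Lemma frob_add m n x : frob (m + n) x = frob n (frob m x).
Proof. by rewrite /frob expnD exprM. Qed.

Lemma frob_mul m n x : frob m x = x -> frob (m * n) x = x.
Proof.
move=> fx; elim: n => [|n IH]; first by rewrite muln0.
by rewrite mulnS frob_add fx.
Qed.

(** All iterates of x under Frobenius are roots of one polynomial over F_l, so two
    of them coincide; Frobenius is injective. *)
Lemma frob_periodic x : exists m, (0 < m)%N && (frob m x == x).
Proof.
have [p mon_p px] := int_io x.
have frob_root y : root (map_poly io p) y -> root (map_poly io p) (y ^+ l).
  pose F := pFrobenius_aut pchar_E.
  rewrite -(fmorph_root F) -map_poly_comp /= pFrobenius_autE.
  rewrite (eq_map_poly (g := io)) // => a /=.
  by rewrite pFrobenius_autE -rmorphXn; have := expf_card a; rewrite card_Fp // => ->.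
have frob_roots i : root (map_poly io p) (frob i x).
  elim: i => [|i IH]; first by rewrite /frob expr1.
  by rewrite /frob expnSr exprM; apply: frob_root.
pose s := [seq frob i x | i <- iota 0 (size p)].
have size_s : size s = size p by rewrite size_map size_iota.
have : ~~ uniq s.
  apply/negP => uniq_s; have : (size s < size (map_poly io p))%N.
    apply: max_poly_roots => //; first by rewrite map_poly_eq0 monic_neq0.
    by apply/allP => _ /mapP[i _ ->].
  by rewrite size_s size_map_poly ltnn.
case/(uniqPn 0)=> i [i' [lt_ii' lt_i's]].
have lt_is := ltn_trans lt_ii' lt_i's; rewrite size_s in lt_is lt_i's.
rewrite !(nth_map 0%N) ?size_iota // !nth_iota // !add0n => eq_f.
exists (i' - i)%N; rewrite subn_gt0 lt_ii' /=; apply/eqP/(@frob_inj i).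
by rewrite -frob_add subnK // ltnW.
Qed.

(** The degree of x over F_l, as the length of its Frobenius orbit. *)
Definition fdeg (x : E) : nat := ex_minn (frob_periodic x).

Lemma fdegP x m : frob m x = x <-> (fdeg x %| m)%N.
Proof.
rewrite /fdeg; case: ex_minnP => d /andP[d_gt0 /eqP fd] min_d; split=> [fm|/dvdnP[c ->]].
  have fr : frob (m %% d) x = x.
    apply: (@frob_inj (m %/ d * d)%N).
    by rewrite -frob_add addnC -divn_eq fm mulnC frob_mul.
  rewrite /dvdn; apply/negPn; rewrite -lt0n; apply/negP => r_gt0.
  have := min_d (m %% d)%N; rewrite r_gt0 fr eqxx => /(_ isT).
  by rewrite leqNgt ltn_pmod.
by rewrite mulnC frob_mul.
Qed.

Lemma fdeg_gt0 x : (0 < fdeg x)%N.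
Proof. by rewrite /fdeg; case: ex_minnP => d /andP[]. Qed.

Variables (q kap : nat).
Hypotheses (pr_q : prime q) (kap_gt0 : (0 < kap)%N) (neq_lq : l <> q).

(** The union of the fields F_{l^m} with m not divisible by q^kap. *)
Definition small_q_degree : {pred E} :=
  fun x => ~~ (q ^ kap %| fdeg x)%N.

Lemma mem_small_q_degree m x :
  frob m x = x -> ~~ (q ^ kap %| m)%N -> x \in small_q_degree.
Proof. by move/fdegP => dm; apply: contra => qd; apply: dvdn_trans dm. Qed.

(** If x and y lie in F_{l^a} and F_{l^b}, both lie in F_{l^lcm(a, b)}, and a prime
    power divides a least common multiple only if it divides one of the two
    numbers. *)
Lemma small_q_degree_divring_closed : divring_closed small_q_degree.
Proof.
have fix2 x y : x \in small_q_degree -> y \in small_q_degree -> exists m,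
    [/\ frob m x = x, frob m y = y & ~~ (q ^ kap %| m)%N].
  move=> kx ky; exists (lcmn (fdeg x) (fdeg y)); split.
  - by apply/fdegP/dvdn_lcml.
  - by apply/fdegP/dvdn_lcmr.
  have dx := fdeg_gt0 x; have dy := fdeg_gt0 y.
  rewrite pfactor_dvdn ?lcmn_gt0 ?dx //logn_lcm // leq_max negb_or.
  by rewrite -!pfactor_dvdn //; apply/andP.
split=> [|x y kx ky|x y kx ky].
- apply: (@mem_small_q_degree 1); first by rewrite /frob expr1n.
  by rewrite dvdn1 -(exp1n kap) eqn_exp2r // gtn_eqF ?prime_gt1.
- have [m [fx fy nm]] := fix2 x y kx ky.
  by apply: (mem_small_q_degree _ nm); rewrite frobB fx fy.
have [m [fx fy nm]] := fix2 x y kx ky.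
by apply: (mem_small_q_degree _ nm); rewrite frobM frobV fx fy.
Qed.

Lemma dvdn_bounded_q_part (d e : nat) :
  (d %| q.-1 * q ^ e)%N -> ~~ (q ^ kap %| d)%N -> (d %| q.-1 * q ^ kap.-1)%N.
Proof.
move=> d_dvd nd; have d_gt0 : (0 < d)%N.
  by case: d nd {d_dvd} => //; rewrite dvdn0.
rewrite -(partnC q d_gt0) p_part mulnC dvdn_mul //.
  have : (d`_q^' %| q.-1 * q ^ e)%N by apply: dvdn_trans d_dvd; apply: dvdn_part.
  rewrite Gauss_dvdl // coprimeXr // coprime_sym prime_coprime //.
  by rewrite -p'natE // part_pnat.
by apply: dvdn_exp2l; rewrite -ltnS prednK // ltnNge -pfactor_dvdn.
Qed.

Lemma frob_prim_root (n m : nat) (w : E) : n.-primitive_root w ->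
  frob m w = w <-> (n %| l ^ m - 1)%N.
Proof.
move=> prim_w; have lm_gt0 : (0 < l ^ m)%N by rewrite expn_gt0 prime_gt0.
rewrite /frob -eqn_mod_dvd // -(eq_prim_root_expr prim_w) expr1.
by split=> /eqP.
Qed.

Let M0 := (q.-1 * q ^ kap.-1)%N.

Lemma qpow_prim_root s : exists w : E, (q ^ s).-primitive_root w.
Proof.
apply: closed_prim_root_exists; rewrite natrX expf_neq0 //.
rewrite -(dvdn_pcharf pchar_E) dvdn_prime2 //; exact/eqP.
Qed.

(** By Euler, the degree of w divides (q-1) q^(s-1); if w is in the subfield, its
    q-part is less than q^kap. *)
Lemma frob_qpow_root s (w : E) :
  (q ^ s).-primitive_root w -> w \in small_q_degree -> frob M0 w = w.
Proof.
move=> prim_w kw; apply/fdegP; apply: (@dvdn_bounded_q_part _ s.-1) => //.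
apply/fdegP/(frob_prim_root _ prim_w).
rewrite -eqn_mod_dvd ?expn_gt0 ?prime_gt0 //.
case: s prim_w => [|s] prim_w; first by rewrite !modn1.
rewrite -totient_pfactor //; apply/eqP/Euler_exp_totient.
by rewrite coprimeXr // prime_coprime // dvdn_prime2 //; apply/eqP.
Qed.

Lemma M0_ndvd : ~~ (q ^ kap %| M0)%N.
Proof.
rewrite /M0 -{1}(prednK kap_gt0) expnS dvdn_pmul2r ?expn_gt0 ?prime_gt0 //.
rewrite gtnNdvd // -?subn1 ?subn_gt0 ?prime_gt1 //.
by rewrite subn1 ltn_predL prime_gt0.
Qed.

(** alpha is a root of unity of least q-power order outside the subfield.  It
    exists because the roots of unity of q-power order inside are all fixed by
    one power of Frobenius, hence finite in number.  That power fixes alpha^q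
    but not alpha, so it multiplies alpha by a primitive q-th root of unity. *)
Lemma Kummer_generator : exists alpha zeta : E,
  [/\ alpha \notin small_q_degree, alpha ^+ q \in small_q_degree, zeta \in small_q_degree,
      q.-primitive_root zeta & frob M0 zeta = zeta /\ frob M0 alpha = zeta * alpha].
Proof.
have kap_pred_ndvd : ~~ (q ^ kap %| q.-1)%N.
  by apply: contra M0_ndvd => /dvdn_mulr; apply.
have [k1 kB kV] := small_q_degree_divring_closed.
pose W s := xchoose (qpow_prim_root s).
have prim_W s : (q ^ s).-primitive_root (W s) by apply: xchooseP.
have exW : exists s, W s \notin small_q_degree.
  pose s := (l ^ M0)%N; exists s; apply/negP => kW.
  have /frob_prim_root := frob_qpow_root (prim_W s) kW; move/(_ _ (prim_W s)).
  move/dvdn_leq; rewrite subn_gt0 => le_qs.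
  have lM_gt1 : (1 < l ^ M0)%N.
    apply: leq_trans (prime_gt1 pr_l) _; rewrite -{1}(expn1 l) leq_exp2l ?prime_gt1 //.
    by rewrite /M0 muln_gt0 expn_gt0 (prime_gt0 pr_q) andbT -ltnS prednK ?prime_gt1 ?prime_gt0.
  have := leq_trans (le_qs lM_gt1) (leq_subr 1 _).
  by rewrite leqNgt ltn_expl ?prime_gt1.
case: (ex_minnP exW) => s nkW minW.
case: s nkW minW => [|s] nkW minW.
  have := prim_expr_order (prim_W 0%N); rewrite expn0 expr1 => W1.
  by move: nkW; rewrite W1 k1.
have kW : W s \in small_q_degree by apply: contraT => /minW; rewrite ltnn.
set alpha := W s.+1 in nkW; have prim_a : (q ^ s.+1).-primitive_root alpha by [].
have fa_q : frob M0 (alpha ^+ q) = alpha ^+ q.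
  have /(prim_rootP (prim_W s))[i ->] : (alpha ^+ q) ^+ (q ^ s) = 1.
    by rewrite -exprM -expnS prim_expr_order.
  by rewrite /frob exprAC -/(frob M0 _) (frob_qpow_root (prim_W s)).
have nz_a : alpha != 0.
  by apply: contraNneq nkW => ->; rewrite -(subrr 1) kB.
pose zeta := frob M0 alpha / alpha.
have zq : zeta ^+ q = 1.
  rewrite /zeta exprMn exprVn -{1}fa_q /frob exprAC mulfV //.
  by rewrite !expf_neq0.
have z1 : zeta != 1.
  apply: contra nkW => /eqP z1; apply: (mem_small_q_degree _ M0_ndvd).
  by rewrite -[LHS](divfK nz_a) -/zeta z1 mul1r.
have prim_z := prime_prim_root pr_q zq z1.
have fz m : (q.-1 %| m)%N -> frob m zeta = zeta.
  case/dvdnP=> c ->; rewrite mulnC frob_mul //; apply/(frob_prim_root _ prim_z).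
  rewrite -eqn_mod_dvd ?expn_gt0 ?prime_gt0 //.
  rewrite -[q.-1]/(q.-1) -totient_prime //; apply/eqP/Euler_exp_totient.
  by rewrite prime_coprime // dvdn_prime2 //; apply/eqP.
exists alpha, zeta; split=> //.
- by apply: (mem_small_q_degree fa_q M0_ndvd).
- by apply: (mem_small_q_degree (fz _ (dvdnn _)) kap_pred_ndvd).
by split; [exact/fz/dvdn_mulr | rewrite /zeta divfK].
Qed.

(** The sum is fixed by the l^M-power map, which permutes its terms cyclically. *)
Lemma trace_small_q_degree (M : nat) (w : E) :
  frob (M * q) w = w -> ~~ (q ^ kap %| M)%N ->
  \sum_(i < q) frob (M * i) w \in small_q_degree.
Proof.
move=> fw; apply: mem_small_q_degree; rewrite (big_morph _ (frobD M) (frob0 M)).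
under eq_bigr => i _ do rewrite -frob_add addnC -mulnS.
case: q fw (prime_gt0 pr_q) => // q' fw _.
rewrite big_ord_recr big_ord_recl /= fw muln0 addrC; congr (_ + _).
Qed.

End Frobenius.

(** * Exponents of Frobenius type *)

Section Arithmetic.
Local Open Scope nat_scope.

Lemma dvdn_exp_sub1 (m l s : nat) : 0 < l ->
  (m %| l ^ s - 1) = (l ^ s == 1 %[mod m]).
Proof. by move=> l_gt0; rewrite eqn_mod_dvd // expn_gt0 l_gt0. Qed.

Lemma is_ordP (m l r s : nat) : 0 < l -> is_ord m l r ->
  (m %| l ^ s - 1) = (r %| s).
Proof.
move=> l_gt0 [r_gt0]; rewrite dvdn_exp_sub1 // => /eqP lr min_r.
have lrc c : l ^ (r * c) = 1 %[mod m].
  by rewrite expnM -modnXm lr modnXm exp1n.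
apply/idP/idP => [ls|/dvdnP[c ->]]; last by rewrite dvdn_exp_sub1 // mulnC; apply/eqP.
rewrite /dvdn; apply/negPn; rewrite -lt0n; apply/negP => s_gt0.
have := min_r _ s_gt0; rewrite leqNgt ltn_pmod // => /implyP; rewrite implybF => /negP[].
move: ls; rewrite !dvdn_exp_sub1 // {1}(divn_eq s r) expnD mulnC.
by rewrite -modnMmr [_ %/ r * r]mulnC lrc modnMmr muln1.
Qed.

Lemma coprime_prime_divisors (a n : nat) : 0 < n ->
  (forall p, prime p -> p %| n -> ~~ (p %| a)) -> coprime a n.
Proof.
move=> n_gt0 nop; apply/negPn/negP => nco.
have gt1 : 1 < gcdn a n by rewrite ltn_neqAle eq_sym nco gcdn_gt0 n_gt0 orbT.
have pr_p := pdiv_prime gt1; have pd := pdiv_dvd (gcdn a n).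
have := nop _ pr_p (dvdn_trans pd (dvdn_gcdr _ _)).
by rewrite (dvdn_trans pd (dvdn_gcdl _ _)).
Qed.

(** If v = 1 modulo every prime divisor p of n, then 1 + v + ... + v^(q-1) = q is
    nonzero modulo each of them, so v^q = 1 modulo n forces v = 1; this applies
    to v = u^(q^(i-1)), and so on down to u. *)
Lemma root_mod_descent (n q u i : nat) : 0 < n -> prime q ->
  (forall p, prime p -> p %| n -> p <> q) ->
  (forall p, prime p -> p %| n -> u = 1 %[mod p]) ->
  u ^ (q ^ i) = 1 %[mod n] -> u = 1 %[mod n].
Proof.
move=> n_gt0 pr_q npq; have q_gt0 := prime_gt0 pr_q.
elim: i u => [|i IH] u up; first by rewrite expn1.
rewrite expnSr expnM => uq; apply: IH => //; move: uq.
set v := u ^ (q ^ i) => vq.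
have vp p : prime p -> p %| n -> v = 1 %[mod p].
  by move=> pr_p pn; rewrite /v -modnXm up // modnXm exp1n.
have [v0|v_gt0] := posnP v; first by move: vq; rewrite v0 exp0n.
apply/eqP; rewrite eqn_mod_dvd //.
have : n %| v ^ q - 1 by rewrite dvdn_exp_sub1 //; apply/eqP.
rewrite subn1 predn_exp -subn1 Gauss_dvdl // coprime_sym.
apply: coprime_prime_divisors => // p pr_p pn.
have : \sum_(i < q) v ^ i = q %[mod p].
  rewrite -modn_summ (eq_bigr (fun=> 1 %% p)) => [|k _].
    by rewrite modn_summ sum_nat_const card_ord muln1.
  by rewrite -modnXm vp // modnXm exp1n.
by rewrite /dvdn => ->; rewrite -/(p %| q) dvdn_prime2 //; apply/eqP/npq.
Qed.

End Arithmetic.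

(** The q-part of ord_n(l) is q^kap: [root_mod_descent] removes any further factor
    q.  With ord_n(l) = q^kap d0, put e = d0^(q-1), which is 1 modulo q; then M
    is q^(kap-1) d0 times a unit modulo q, so that modulo n every power of
    l^(q^(kap-1) d0) is a power of l^M.  The factor (q-1) q^(kap-1) in
    M is the exponent provided by [Kummer_generator]. *)
Lemma frobenius_exponent (kap l q n : nat) (chi : mu_hom q n) :
  prime l -> prime q -> (0 < kap)%N -> in_Ikql kap q l n -> frobenius_type chi l ->
  exists e j : nat, let M := (q.-1 * q ^ kap.-1 * e)%N in
    [/\ e = 1 %[mod q], (n %| l ^ (M * q) - 1)%N, coprime (l ^ M - 1) n,
        coprime q j
      & forall b : 'Z_q, val (chi b) = l ^ (M * (j * b)) %[mod n]]%N.
Proof.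
move=> pr_l pr_q kap_gt0 [n_gt0 nP] frob_chi.
have [n1|n_neq1] := eqVneq n 1%N.
  subst n; exists 1%N, 1%N; split=> //; rewrite ?dvd1n ?coprimen1 //.
  by move=> b; rewrite !modn1.
have [n1|[y [k [d0 [d [gen_y ordn [k_gt0 qd0] d_bd chi_y]]]]]] := frob_chi.
  by rewrite n1 in n_neq1.
have n_gt1 : (1 < n)%N by rewrite ltn_neqAle eq_sym n_neq1.
have l_gt0 := prime_gt0 pr_l; have q_gt0 := prime_gt0 pr_q.
have q_gt1 := prime_gt1 pr_q.
have d0_gt0 : (0 < d0)%N by case: (d0) qd0 => //; rewrite dvdn0.
have logd c : logn q (q ^ c * d0) = c.
  rewrite lognM ?expn_gt0 ?q_gt0 // pfactorK //.
  by rewrite lognE (negPf qd0) !andbF addn0.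
have npq p : prime p -> (p %| n)%N -> p <> q.
  move=> pr_p pn pq; have [_ + _] := nP p pr_p pn; rewrite pq modnn.
  by rewrite modn_small.
have ord_p p : prime p -> (p %| n)%N -> exists r,
    [/\ is_ord p l r, logn q r = kap, (r %| q ^ k * d0)%N & (0 < r)%N].
  move=> pr_p pn; have [_ _ [r ord_r log_r]] := nP p pr_p pn; exists r.
  split=> //; last by case: ord_r.
  rewrite -(is_ordP _ l_gt0 ord_r); apply: dvdn_trans pn _.
  by rewrite (is_ordP _ l_gt0 ordn).
have le_kap_k : (kap <= k)%N.
  have [r [_ log_r r_dvd r_gt0]] := ord_p _ (pdiv_prime n_gt1) (pdiv_dvd n).
  by rewrite -log_r -(logd k) dvdn_leq_log // muln_gt0 expn_gt0 q_gt0.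
have k_kap : k = kap.
  apply/eqP; rewrite eqn_leq le_kap_k andbT.
  suff : (n %| l ^ (q ^ kap * d0) - 1)%N.
    rewrite (is_ordP _ l_gt0 ordn) => /dvdn_leq_log - /(_ q).
    by rewrite !logd; apply; rewrite muln_gt0 expn_gt0 q_gt0.
  rewrite dvdn_exp_sub1 //; apply/eqP.
  apply: (root_mod_descent n_gt0 pr_q npq (i := (k - kap)%N)) => [p pr_p pn|].
    apply/eqP; rewrite -dvdn_exp_sub1 //.
    have [r [ord_r log_r r_dvd r_gt0]] := ord_p p pr_p pn.
    rewrite (is_ordP _ l_gt0 ord_r) -(partnC q r_gt0) p_part log_r.
    apply: dvdn_mul => //; have co : coprime r`_q^' (q ^ k).
      by rewrite coprimeXr // coprime_sym prime_coprime // -p'natE // part_pnat.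
    rewrite -(Gauss_dvdr _ co); apply: dvdn_trans r_dvd; exact: dvdn_part.
  rewrite -expnM; apply/eqP; rewrite -dvdn_exp_sub1 // (is_ordP _ l_gt0 ordn).
  by rewrite mulnAC -expnD subnKC.
subst k; set M0 := (q.-1 * q ^ kap.-1)%N.
have q1_gt0 : (0 < q.-1)%N by rewrite -ltnS prednK.
have qq1 : ~~ (q %| q.-1)%N by rewrite gtnNdvd // ltn_predL.
have co_d0 : coprime d0 q by rewrite coprime_sym prime_coprime.
have qS : (q ^ kap = q * q ^ kap.-1)%N by rewrite -expnS prednK.
pose e := (d0 ^ q.-1)%N.
have e1 : (e = 1 %[mod q])%N.
  by rewrite /e -totient_prime //; apply: Euler_exp_totient.
pose M := (M0 * e)%N.
have lXmod a b : (a = b %[mod q ^ kap * d0])%N -> (l ^ a = l ^ b %[mod n])%N.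
  have lN : (l ^ (q ^ kap * d0) = 1 %[mod n])%N.
    by apply/eqP; rewrite -dvdn_exp_sub1 // (is_ordP _ l_gt0 ordn).
  have red c : (l ^ c = l ^ (c %% (q ^ kap * d0)) %[mod n])%N.
    have lNc : (l ^ (q ^ kap * d0 * (c %/ (q ^ kap * d0))) = 1 %[mod n])%N.
      by rewrite expnM -modnXm lN modnXm exp1n.
    rewrite {1}(divn_eq c (q ^ kap * d0)) expnD [(_ %/ _ * _)%N]mulnC.
    by rewrite -modnMml lNc modnMml mul1n.
  by rewrite red => ->; rewrite -red.
have ZqE : (Zp_trunc q).+2 = q := Zp_cast q_gt1.
have [i1 i1E] : exists i1, (1%R : 'Z_q) = (y ^+ i1)%g.
  by apply/cycleP; rewrite -(eqP gen_y) inE.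
(* M j = (q-1)^2 d0^(q-1) d i1 q^(kap-1) d0, where (q-1)^2 d0^(q-1) = 1 mod q *)
pose j := (d * q.-1 * d0 * i1)%N.
exists e, j; rewrite -/M; split=> //.
- rewrite (is_ordP _ l_gt0 ordn) /M /M0 qS /e.
  rewrite -(prednK q1_gt0) expnS; apply/dvdnP.
  exists (q.-1.-1.+1 * d0 ^ q.-1.-1)%N; ring.
- apply: coprime_prime_divisors => // p pr_p pn.
  have [r [ord_r log_r r_dvd r_gt0]] := ord_p p pr_p pn.
  rewrite (is_ordP _ l_gt0 ord_r); apply/negP => rM.
  have : (q ^ kap %| M)%N by apply: dvdn_trans rM; rewrite pfactor_dvdn // log_r.
  rewrite /M /M0 mulnAC qS dvdn_pmul2r ?expn_gt0 ?q_gt0 //.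
  rewrite Euclid_dvdM // (negPf qq1) /= /e Euclid_dvdX // (negPf qd0).
  by [].
- rewrite prime_coprime // !Euclid_dvdM // (negPf qq1) (negPf qd0) !orbF.
  rewrite gtnNdvd /=; last 2 first.
  + by case/andP: d_bd.
  + by case/andP: d_bd => _; rewrite -ltnS subn1 prednK.
  apply/negP => /dvdnP[c i1c].
  move/(congr1 val): i1E; rewrite Zp_expg /= i1c mulnA.
  by move: (y * c)%N => yc; rewrite ZqE modnMl modn_small.
move=> b; rewrite mulnA.
have -> : val (chi b) = (l ^ (d0 * d * q ^ (kap - 1)))%:R ^+ (i1 * b).
  apply: etrans _ (congr1 (fun u => u ^+ (i1 * b)) chi_y).
  rewrite -FinRing.val_unitX -[RHS]/(val (chi y ^+ (i1 * b))%g) -morphX ?inE //.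
  rewrite expgM -i1E; congr (val (chi _)); apply: val_inj.
  by rewrite Zp_expg /= (modn_small (isT : 1 < (Zp_trunc q).+2)%N) mul1n modn_small.
rewrite -natrX val_Zp_nat // modn_mod -expnM; apply: lXmod.
have -> : (M * j * b = q ^ kap.-1 * d0 * (q.-1 * q.-1 * e * (d * i1 * b)))%N.
  by rewrite /M /M0 /j; ring.
have -> : (d0 * d * q ^ (kap - 1) * (i1 * b) = q ^ kap.-1 * d0 * (d * i1 * b))%N.
  by rewrite subn1; ring.
have -> : (q ^ kap * d0 = q ^ kap.-1 * d0 * q)%N by rewrite qS; ring.
rewrite -!muln_modr; congr (_ * _)%N.
have q1q1 : (q.-1 * q.-1 = 1 %[mod q])%N.
  have -> : (q.-1 * q.-1 = q.-1.-1 * q + 1)%N.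
    by case: (q) q_gt1 => [|[|q']] //= _; ring.
  by rewrite modnMDl.
have q1q1e : (q.-1 * q.-1 * e = 1 %[mod q])%N.
  by rewrite -modnMml q1q1 modnMml mul1n.
by rewrite -[RHS]modnMml q1q1e modnMml mul1n.
Qed.

(** * The theorem *)

Theorem theorem9 (l q : nat) (hl : prime l) (hq : prime q) (hq3 : (3 <= q)%N)
    (hlq : l <> q)
    (Flbar : closedFieldType) (iota : {rmorphism 'F_l -> Flbar})
    (hFlbar : is_algebraic_closure iota)
    (KK : forall n : nat, mu_hom q n -> Prop)
    (hKK : consistent_balanced_collection KK)
    (hfrob : frobenius_collection l KK) :
  exists (k : fieldType) (_ : {rmorphism k -> Flbar})
      (Kbar : closedFieldType)
      (kappa : {rmorphism {fraction {poly k}} -> Kbar})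
      (X : projective_variety kappa),
    [/\ is_algebraic_closure kappa,
        nontrivial_severi_brauer q X
      & forall (n : nat) (chi : mu_hom q n), KK n chi ->
          Aut_contains X (mu_group chi)].
Proof.
have [kap kap_gt0 KK_frob] := hfrob.
(* For q = q'.+2 the type of indices 'I_q is the ring of integers modulo q. *)
case: q hq hq3 hlq KK hKK hfrob KK_frob => [|[|q']] // pr_q _ neq_lq KK _ _ KK_frob.
set q := q'.+2 in pr_q neq_lq KK KK_frob *.
have [alpha [zeta [nk_a k_aq k_z prim_z [fz fa]]]] :=
  Kummer_generator hl hFlbar pr_q kap_gt0 neq_lq.
set M0 := (q.-1 * q ^ kap.-1)%N in fz fa.
have [k [j jE]] := subfield_exists (small_q_degree_divring_closed hl hFlbar pr_q kap_gt0).
have [L [f int_f]] := rational_function_closure hFlbar.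
(* The prime field is contained in k. *)
have iota_k a : exists b, j b = iota a.
  by exists (a : nat)%:R; rewrite rmorph_nat -(rmorph_nat iota) natr_Zp.
have [kappa int_kappa kappaE] :=
  rational_function_subfield_closure hFlbar iota_k int_f.
have [zk zkE] := (jE _).1 k_z; have [bk bkE] := (jE _).1 k_aq.
pose cm : {rmorphism Flbar -> L} := f \o @tofrac _ \o @polyC Flbar.
pose ck : {rmorphism k -> {fraction {poly k}}} := @tofrac _ \o @polyC k.
have ckE y : kappa (ck y) = cm (j y) by rewrite /= kappaE map_polyC.
have [theta theta_q] := closed_root_exists q.-1 (kappa (tofrac 'X)).
have pchar_E : l \in [pchar Flbar] by rewrite (fmorph_pchar iota) pchar_Fp.
have nz_nat m : ~~ (l %| m)%N -> m%:R != 0 :> Flbar.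
  by rewrite (dvdn_pcharf pchar_E).
have prim_ck : q.-primitive_root (ck zk).
  by rewrite fmorph_primitive_root -(fmorph_primitive_root j) zkE.
have nz_q : q%:R != 0 :> {fraction {poly k}}.
  rewrite -(rmorph_nat ck) fmorph_eq0 -(fmorph_eq0 j) rmorph_nat nz_nat //.
  by rewrite dvdn_prime2 //; apply/eqP.
have alpha_q : cm alpha ^+ q = kappa (ck bk) by rewrite ckE bkE rmorphXn.
have nz_a : alpha != 0.
  apply: contraNneq nk_a => ->; apply/jE; exists 0; exact: rmorph0.
have nz_cm : cm alpha != 0 by rewrite fmorph_eq0.
have nz_theta : theta != 0.
  apply: contra_eq_neq theta_q => ->.
  by rewrite expr0n eq_sym fmorph_eq0 tofrac_eq0 polyX_eq0.
pose X := twisted_variety prim_ck nz_q alpha_q theta_q nz_cm nz_theta.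
exists k, j, L, kappa, X; split=> //.
  apply: twisted_nontrivial => y0 y1 norm_y i.
  apply: (t_not_norm (z := zk) (b := bk) kappaE pr_q) norm_y i => //.
    by rewrite -(fmorph_primitive_root j) zkE.
  by move=> y; apply: contraNneq nk_a => <-; apply/jE; exists y.
move=> n chi /KK_frob[inI frob_chi].
have [n_gt0 nP] := inI.
have [e [jj]] := frobenius_exponent hl pr_q kap_gt0 inI frob_chi.
set M := (_ * e)%N => -[e1 nM coM co_qj chiE].
have nln : ~~ (l %| n)%N by apply/negP => /(nP l hl)[].
have co_nq : coprime n q.
  rewrite coprime_sym prime_coprime //; apply/negP => /(nP q pr_q)[_ + _].
  by rewrite modnn modn_small.
have [xi prim_xi] := closed_prim_root_exists (nz_nat n nln).
have lMX i : ((l ^ M) ^ i = l ^ (M * i))%N by rewrite expnM.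
have f_xi : frob l (M * q) xi = xi by apply/(frob_prim_root hl _ prim_xi).
have f_zM i : frob l (M * i) zeta = zeta by rewrite /M -mulnA; apply: frob_mul.
have f_aM i : frob l (M * i) alpha = zeta ^+ i * alpha.
  have f_a0 m : frob l (M0 * m) alpha = zeta ^+ m * alpha.
    elim: m => [|m IH]; first by rewrite muln0 /frob !expr1 mul1r.
    rewrite mulnS addnC frob_add IH frobM fa mulrA; congr (_ * _).
    by rewrite exprSr /frob exprAC -/(frob l M0 zeta) fz.
  rewrite /M -mulnA f_a0; congr (_ * _); apply/eqP.
  by rewrite (eq_prim_root_expr prim_z) -modnMml e1 modnMml mul1n.
have M_ndvd : ~~ (q ^ kap %| M)%N.
  rewrite /M mulnAC -{1}(prednK kap_gt0) expnS dvdn_pmul2r ?expn_gt0 //.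
  rewrite Euclid_dvdM // negb_or gtnNdvd //= /dvdn e1 modn_small //.
have xi_per : cm xi ^+ ((l ^ M) ^ q)%N = cm xi by rewrite lMX -rmorphXn -/(frob l _ _) f_xi.
apply: (mu_group_Aut prim_ck nz_q alpha_q theta_q nz_cm nz_theta
  (xi := cm xi) (lam := (l ^ M)%N) (jj := jj)) => //.
- by rewrite fmorph_primitive_root.
- by rewrite expn_gt0 prime_gt0.
- by move=> b; rewrite lMX.
move=> s m m' x.
pose w := alpha ^+ m / alpha ^+ m' * ((xi ^+ x) ^+ q.-1 * (xi ^+ ((l ^ M) ^ s)%N) ^+ x).
have frobX i (u : Flbar) d : frob l i (u ^+ d) = frob l i u ^+ d.
  by rewrite /frob exprAC.
have wE i : frob l (M * i) w = zeta ^+ (i * m) / zeta ^+ (i * m') *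
    (alpha ^+ m / alpha ^+ m') *
    ((xi ^+ ((l ^ M) ^ i)%N ^+ x) ^+ q.-1 * xi ^+ ((l ^ M) ^ (i + s))%N ^+ x).
  rewrite /w frobM; congr (_ * _).
    by rewrite frobM frobV !frobX f_aM !exprMn -!exprM invfM mulrACA.
  by rewrite frobM !frobX /frob -lMX expnD [in RHS]exprM.
have [y yE] : exists y, j y = \sum_(i < q) frob l (M * i) w.
  apply/jE/(trace_small_q_degree hl) => //; rewrite wE.
  have zq d : zeta ^+ (q * d) = 1.
    by rewrite exprM (prim_expr_order prim_z) expr1n.
  have xi_per0 : xi ^+ ((l ^ M) ^ q)%N = xi by rewrite lMX -/(frob l _ _) f_xi.
  by rewrite !zq divr1 mul1r expnD exprM xi_per0.
exists (ck y); rewrite ckE yE rmorph_sum; apply: eq_bigr => i _.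
rewrite wE ckE zkE /xiconj xi_lam_mod //.
by rewrite !rmorphM !fmorphV !rmorphXn.
Qed.
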